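(* Let $X$ be a spectrally negative Lévy process of bounded variation, with arbitrary Lévy measure $\Pi$, and let $\overline{\Pi}(x)=\Pi(x,\infty)$ for $x>0$. The following conditions are equivalent: (i) $W\in C^1(0,\infty)$; (ii) $W^{(q)}\in C^1(0,\infty)$ for all $q\ge0$; (iii) $\overline{\Pi}\in C^0(0,\infty)$. Here $W^{(q)}$ is the $q$-scale function of $X$ and $W=W^{(0)}$.
   Context: A spectrally negative Lévy process $X$ is a real-valued Lévy process with no positive jumps which, as usual, is not the negative of a subordinator (paths not monotone decreasing). Its triplet is $(\gamma,\sigma,\Pi)$ with $\gamma\in\mathbb{R}$, $\sigma\ge 0$, and $\Pi$ a measure on $(0,\infty)$ with $\int_0^\infty(1\wedge x^2)\Pi(dx)<\infty$ (the Lévy measure is carried by $(0,\infty)$ although jumps are negative); its Laplace exponent is $$\psi(\theta)=\log \mathbb{E}(e^{\theta X_1})=\gamma\theta+\tfrac12\sigma^2\theta^2-\int_0^\infty\left(1-e^{-\theta x}-\theta x1_{\{0<x<1\}}\right)\Pi(dx),\quad \theta\ge0.$$ $\Phi(0)\ge 0$ is the largest real root of $\psi$ on $[0,\infty)$; the restriction $\psi:[\Phi(0),\infty)\to[0,\infty)$ is a bijection with inverse $\Phi$. For $q\ge0$ the $q$-scale function $W^{(q)}:\mathbb{R}\to[0,\infty)$ is the unique function with $W^{(q)}(x)=0$ for $x<0$ which on $[0,\infty)$ is continuous and non-decreasing with $\int_0^\infty e^{-\theta x}W^{(q)}(x)\,dx=1/(\psi(\theta)-q)$ for $\theta>\Phi(q)$.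 Here $\Pi$ is not assumed to have a density. *)

(* Defs.v *)
From mathcomp Require Import all_boot all_order all_algebra.
From mathcomp Require Import all_classical all_reals all_analysis.

Set Implicit Arguments.
Unset Strict Implicit.
Unset Printing Implicit Defensive.

Import Order.TTheory GRing.Theory Num.Theory.
Import numFieldNormedType.Exports.

Local Open Scope classical_set_scope.
Local Open Scope ring_scope.

(* Processes are families [X : R -> {RV P >-> R}]; only the times t >= 0 are
   ever constrained or used. *)

Section LevyProcess.
Context d (T : measurableType d) (R : realType) (P : probability T R).
Implicit Type X : R -> {RV P >-> R}.

Definition cadlag (f : R -> R) :=
  (forall t : R, 0 <= t -> f s @[s --> t^'+] --> f t) /\
  (forall t : R, 0 < t -> cvg (f s @[s --> t^'-])).

Definition independent_increments X :=
  forall (n : nat) (t : nat -> R) (B : nat -> set R),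
    0 <= t 0%N -> {homo t : i j / (i <= j)%N >-> i <= j} ->
    (forall i, measurable (B i)) ->
    P (\bigcap_(i in `I_n) [set w | B i (X (t i.+1) w - X (t i) w)]) =
    (\prod_(i < n) P [set w | B i (X (t i.+1) w - X (t i) w)%R])%E.

Definition stationary_increments X :=
  forall s h : R, 0 <= s -> 0 <= h -> forall B : set R, measurable B ->
    P [set w | B (X (s + h) w - X s w)] = P [set w | B (X h w)].

Definition levy_process X :=
  [/\ {ae P, forall w, X 0 w = 0},
      {ae P, forall w, cadlag (X ^~ w)},
      independent_increments X &
      stationary_increments X].

Definition no_positive_jumps X :=
  {ae P, forall w, forall t : R, 0 < t -> X t w <= lim (X s w @[s --> t^'-])}.

Definition monotone_decreasing_paths X :=
  {ae P, forall w, forall s t : R, 0 <= s -> s <= t -> X t w <= X s w}.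

Definition spectrally_negative_levy_process X :=
  [/\ levy_process X, no_positive_jumps X & ~ monotone_decreasing_paths X].

Definition bounded_variation_paths X :=
  {ae P, forall w, forall t : R, 0 <= t -> bounded_variation 0 t (X ^~ w)}.

End LevyProcess.

Section LevyTriplet.
Context (R : realType).
Variables (gamma sigma : R) (Pi : {measure set R -> \bar R}).

Definition levy_measure :=
  Pi `]-oo, 0]%classic = 0%E /\
  (\int[Pi]_(x in `]0%R, +oo[) (Num.min 1 (x ^+ 2))%:E < +oo)%E.

Definition levy_khintchine (theta : R) : R :=
  gamma * theta + 2^-1 * sigma ^+ 2 * theta ^+ 2 -
  \int[Pi]_(x in `]0, +oo[)
     (1 - expR (- (theta * x)) - theta * x * \1_(`]0, 1[ : set R) x).

(* (gamma, sigma, Pi) is the triplet of X; [lne] is the extended-real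
   logarithm, so the equation contains the finiteness of E(e^{theta X_1}). *)
Definition levy_triplet d (T : measurableType d) (P : probability T R)
    (X : R -> {RV P >-> R}) :=
  [/\ 0 <= sigma, levy_measure &
      forall theta : R, 0 <= theta ->
        lne 'E_P[fun w => expR (theta * X 1 w)] =
        (levy_khintchine theta)%:E].

Definition tail (x : R) : R := fine (Pi `]x, +oo[%classic).

End LevyTriplet.

Section ScaleFunction.
Context (R : realType).
Variable psi : R -> R.

Definition Phi0 : R := sup [set theta | 0 <= theta /\ psi theta = 0].

Definition Phi : R -> R := 'pinv_(fun=> 0) `[Phi0, +oo[ psi.

Definition scale_function (q : R) (W : R -> R) :=
  [/\ forall x : R, x < 0 -> W x = 0,
      forall x, 0 <= W x,
      {within `[0, +oo[, continuous W},
      {in `[0, +oo[ &, {homo W : x y / x <= y}} &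
      forall theta : R, Phi q < theta ->
        (\int[lebesgue_measure]_(x in `[0%R, +oo[)
           (expR (- (theta * x)) * W x)%:E = ((psi theta - q)^-1)%:E)%E].

End ScaleFunction.

Section Smoothness.
Context (R : realType).

Definition C0_pos (f : R -> R) := forall x : R, 0 < x -> {for x, continuous f}.

Definition C1_pos (f : R -> R) :=
  (forall x : R, 0 < x -> derivable f x 1) /\ C0_pos f^`()%classic.

End Smoothness.

(* Main.v *)
(* For bounded variation, psi(s) = delta s - s int_0^oo e^(-s x) tail(x) dx with
   delta > 0, so 1 / (psi - q) = (delta s (1 - K^(s)))^-1 where
   K = (tail + q) / delta.  Expanding the geometric series, W q is
   delta^-1 (1 + int u) with u the sum of the convolution powers of K, and
   u = K + K * u.  After the exponential tilting k(x) = e^(- theta x) K(x), of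
   total mass < 1, the identity x (k * v) = k * (x k + (x k) * v + x v), whose
   last factor is bounded because k is nonincreasing, shows that u - K is
   continuous on (0, oo) although K need not be.  Hence W q is C^1 if and only if
   the primitive of the monotone function K is, i.e. if and only if the tail of Pi
   is continuous; the value of q plays no role.

   Bounded variation of the paths enters as follows: the sums of the n absolute
   increments over [0, 1] are bounded on an event of positive probability, so
   E(1 - e^(-|X_(1/n)|)) = O(1/n) by independence, whence psi(s) = O(s), which
   forces sigma = 0 and int_0^1 x Pi(dx) < oo. *)

From HB Require Import structures.
Require Import Defs.
From mathcomp Require Import all_boot all_order all_algebra.
From mathcomp Require Import all_classical all_reals all_analysis measurable_realfun.
From mathcomp Require Import ring lra.

Set Implicit Arguments.
Unset Strict Implicit.
Unset Printing Implicit Defensive.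

Import Order.TTheory GRing.Theory Num.Theory.
Import numFieldNormedType.Exports.

Local Open Scope classical_set_scope.
Local Open Scope ring_scope.

(** * Convolution of nonnegative functions on the line *)

(** Three points that the overview passes over. [W q] is known only through its Laplace transform,
    so a candidate delta^-1 (1 + int u) is built and identified with [W q] by a uniqueness theorem.
    The tail may jump, hence uniqueness is proved pointwise, from continuity at the single point
    considered. If [W q] is C^1, the primitive of K is differentiable, but at a jump of K the
    fundamental theorem of calculus says nothing. Concavity does: K(x) is the slope of a line lying
    above the primitive and touching it at x, and a differentiable function has only one such slope.
    In the bounded variation part, E(1 - e^(-|X_h|)) = O(h) does not control E(e^(theta X_h)), since
    X_h may be large and positive. The excess is absorbed by e^(l X_h - l / (4 theta)). The choice h
    = 1/m^2, l = m balances the two: E(e^(m X_h)) = e^(psi(m)/m^2) stays bounded because psi grows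
    at most quadratically, while e^(-m/(4 theta)) is o(h). *)

Section Convolution.
Context {R : realType}.
Local Notation mu := (@lebesgue_measure R).
Local Open Scope ereal_scope.
Implicit Types (f g h : R -> \bar R) (a x : R).

Lemma measurable_fun_subl a :
  measurable_fun setT (fun x : R => (a - x)%R : measurableTypeR R).
Proof. by apply: measurable_funB => //; exact: measurable_id. Qed.

Let subl a (x : R) : measurableTypeR R := (a - x)%R.

HB.instance Definition _ a :=
  isMeasurableFun.Build _ _ _ _ (subl a) (measurable_fun_subl a).

Lemma lebesgue_measure_reflect a (A : set R) : measurable A ->
  pushforward mu (subl a) A = mu A.
Proof.
move=> mA; apply/esym/lebesgue_measure_unique => //=.
  exact: measurable_fun_subl.
move=> _ _ [[x y]] _ <-.
rewrite /pushforward/=.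
have -> : subl a @^-1` `]x, y] = `[(a - y)%R, (a - x)%R[%classic.
  apply/seteqP; split => z /=; rewrite !in_itv/= /subl => /andP[? ?];
    apply/andP; split; lra.
rewrite !lebesgue_measure_itv/= !lte_fin -!EFinB.
have -> : (a - y < a - x)%R = (x < y)%R by apply/idP/idP; lra.
by have -> : ((a - x) - (a - y))%R = (y - x)%R by lra.
Qed.

Lemma ge0_integral_reflect f a :
  measurable_fun setT f -> (forall x, 0 <= f x) ->
  \int[mu]_x f (a - x)%R = \int[mu]_x f x.
Proof.
move=> mf f0; transitivity (\int[pushforward mu (subl a)]_(x in setT) f x).
  rewrite ge0_integral_pushforward//; first exact: measurable_fun_subl.
apply: eq_measure_integral => /=; first exact: measurable_fun_subl.
by move=> ? A mA _; exact: lebesgue_measure_reflect.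
Qed.

(** A translation is the composite of two reflections. *)
Lemma ge0_integral_shift f a :
  measurable_fun setT f -> (forall x, 0 <= f x) ->
  \int[mu]_x f (x + a)%R = \int[mu]_x f x.
Proof.
move=> mf f0; rewrite -[RHS](ge0_integral_reflect  a)//.
rewrite -[RHS](ge0_integral_reflect  0%R)//.
  by apply: eq_integral => x _; congr f; lra.
by apply: measurableT_comp => //; exact: measurable_fun_subl.
Qed.

(** Extended-real values and nonnegative arguments make the algebra of convolution pure Tonelli,
    free of integrability conditions. For functions vanishing on x <= 0 this is the convolution on
    the half-line. *)
Definition convol f g (x : R) := \int[mu]_y (f (x - y)%R * g y).

Lemma measurable_convol_kernel f g : measurable_fun setT f ->
  measurable_fun setT g ->
  measurable_fun setT (fun z : R * R => f (z.1 - z.2)%R * g z.2).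
Proof.
move=> mf mg; apply: emeasurable_funM; last first.
  by apply: measurableT_comp => //; exact: measurable_snd.
apply: measurableT_comp => //.
by apply: measurable_funB; [exact: measurable_fst|exact: measurable_snd].
Qed.

Lemma convol_ge0 f g x : (forall x, 0 <= f x) -> (forall x, 0 <= g x) ->
  0 <= convol f g x.
Proof. by move=> f0 g0; apply: integral_ge0 => y _; exact: mule_ge0. Qed.

Lemma measurable_convol f g : measurable_fun setT f -> measurable_fun setT g ->
  (forall x, 0 <= f x) -> (forall x, 0 <= g x) ->
  measurable_fun setT (convol f g).
Proof.
move=> mf mg f0 g0.
apply: (@measurable_fun_fubini_tonelli_F _ _ _ _ _ mu
  (fun z : R * R => f (z.1 - z.2)%R * g z.2)).
  exact: measurable_convol_kernel.
by move=> z; exact: mule_ge0.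
Qed.

Lemma measurable_convol_section f g x : measurable_fun setT f ->
  measurable_fun setT g ->
  measurable_fun setT (fun y : R => f (x - y)%R * g y).
Proof.
move=> mf mg; apply: emeasurable_funM => //.
by apply: measurableT_comp => //; exact: measurable_fun_subl.
Qed.

Lemma convolC f g : measurable_fun setT f -> measurable_fun setT g ->
  (forall x, 0 <= f x) -> (forall x, 0 <= g x) -> convol f g = convol g f.
Proof.
move=> mf mg f0 g0; apply/funext => x; rewrite /convol.
rewrite -(ge0_integral_reflect  x); last 2 first.
  exact: measurable_convol_section.
  by move=> y; exact: mule_ge0.
by apply: eq_integral => y _; rewrite muleC; congr (_ * f _); lra.
Qed.

(** This form of associativity is the one that later brings a factor [K] to the front. After
    Tonelli, the inner integrals of the two sides correspond under the reflection y -> x + s - y. *)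
Lemma convolCA f g h : measurable_fun setT f -> measurable_fun setT g ->
  measurable_fun setT h ->
  (forall x, 0 <= f x) -> (forall x, 0 <= g x) -> (forall x, 0 <= h x) ->
  convol f (convol g h) = convol g (convol f h).
Proof.
move=> mf mg mh f0 g0 h0; apply/funext => x; rewrite /convol.
have swap f1 g1 : measurable_fun setT f1 -> measurable_fun setT g1 ->
    (forall x, 0 <= f1 x) -> (forall x, 0 <= g1 x) ->
    \int[mu]_y (f1 (x - y)%R * \int[mu]_s (g1 (y - s)%R * h s)) =
    \int[mu]_s \int[mu]_y (f1 (x - y)%R * g1 (y - s)%R * h s).
  move=> mf1 mg1 f10 g10.
  transitivity (\int[mu]_y \int[mu]_s (f1 (x - y)%R * g1 (y - s)%R * h s)).
    apply: eq_integral => y _; rewrite -ge0_integralZl//.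
    - by apply: eq_integral => s _; rewrite muleA.
    - exact: measurable_convol_section.
    - by move=> s _; exact: mule_ge0.
  apply: (@fubini_tonelli _ _ _ _ _ mu mu (fun z : R * R =>
    f1 (x - z.1)%R * g1 (z.1 - z.2)%R * h z.2)); last first.
    by move=> z; rewrite !mule_ge0.
  apply: emeasurable_funM; last first.
    by apply: measurableT_comp => //; exact: measurable_snd.
  apply: emeasurable_funM; apply: measurableT_comp => //.
    by apply: measurable_funB => //; exact: measurable_fst.
  by apply: measurable_funB; [exact: measurable_fst|exact: measurable_snd].
rewrite !swap//; apply: eq_integral => s _.
rewrite -(ge0_integral_reflect  (x + s)%R).
- apply: eq_integral => y _; rewrite [f _ * _]muleC; congr (_ * _ * _).
    by congr g; lra.
  by congr f; lra.
- apply: emeasurable_funM => //; apply: emeasurable_funM.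
    by apply: measurableT_comp => //; exact: measurable_fun_subl.
  by apply: measurableT_comp => //; exact: measurable_funB.
- by move=> y; rewrite !mule_ge0.
Qed.

Lemma integral_convol f g : measurable_fun setT f -> measurable_fun setT g ->
  (forall x, 0 <= f x) -> (forall x, 0 <= g x) ->
  \int[mu]_x convol f g x = (\int[mu]_x f x) * \int[mu]_x g x.
Proof.
move=> mf mg f0 g0; rewrite /convol.
transitivity (\int[mu]_y \int[mu]_x (f (x - y)%R * g y)).
  apply: (@fubini_tonelli _ _ _ _ _ mu mu (fun z : R * R => f (z.1 - z.2)%R * g z.2)).
    exact: measurable_convol_kernel.
  by move=> z; exact: mule_ge0.
rewrite -ge0_integralZl//; last exact: integral_ge0.
apply: eq_integral => y _ /=.
rewrite ge0_integralZr//; last first.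
  by apply: measurableT_comp => //; exact: measurable_funB.
by rewrite (@ge0_integral_shift f (- y)%R).
Qed.

Lemma convolD f g h : measurable_fun setT f -> measurable_fun setT g ->
  measurable_fun setT h ->
  (forall x, 0 <= f x) -> (forall x, 0 <= g x) -> (forall x, 0 <= h x) ->
  convol f (g \+ h) = convol f g \+ convol f h.
Proof.
move=> mf mg mh f0 g0 h0; apply/funext => x; rewrite /convol -ge0_integralD//.
- by apply: eq_integral => y _; rewrite ge0_muleDr.
- by move=> y _; exact: mule_ge0.
- exact: measurable_convol_section.
- by move=> y _; exact: mule_ge0.
- exact: measurable_convol_section.
Qed.

Lemma convol_le_sup f g (M : R) x : (0 <= M)%R ->
  measurable_fun setT f -> measurable_fun setT g ->
  (forall x, 0 <= f x) -> (forall x, 0 <= g x) ->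
  (forall x, f x <= M%:E) -> convol f g x <= M%:E * \int[mu]_y g y.
Proof.
move=> M0 mf mg f0 g0 fM; rewrite -ge0_integralZl//.
apply: ge0_le_integral => //.
- by move=> y _; exact: mule_ge0.
- exact: measurable_convol_section.
- exact: measurable_funeM.
- by move=> y _; exact: lee_wpmul2r.
Qed.

End Convolution.

(** * The density of the renewal measure of a nonincreasing kernel *)

Section ConvolutionPositiveHalfLine.
Context {R : realType}.
Local Notation mu := (@lebesgue_measure R).
Local Open Scope ereal_scope.
Implicit Types (f g h : R -> \bar R) (x : R).

Definition timesid f x := x%:E * f x.

Lemma timesid_ge0 f : (forall x, 0 <= f x) -> (forall x, (x <= 0)%R -> f x = 0) ->
  forall x, 0 <= timesid f x.
Proof.
move=> f0 fneg x; rewrite /timesid; have [x0|x0] := leP x 0%R.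
  by rewrite fneg// mule0.
by rewrite mule_ge0// lee_fin ltW.
Qed.

Lemma measurable_timesid f : measurable_fun setT f ->
  measurable_fun setT (timesid f).
Proof. by move=> mf; apply: emeasurable_funM. Qed.

Lemma convol_neg f g x : (forall x, (x <= 0)%R -> f x = 0) ->
  (forall x, (x <= 0)%R -> g x = 0) -> (x <= 0)%R -> convol f g x = 0.
Proof.
move=> fneg gneg x0; apply: integral0_eq => y _.
have [y0|y0] := leP y 0%R; first by rewrite gneg// mule0.
by rewrite fneg ?mul0e//; lra.
Qed.

(** Multiplication by x is a derivation for convolution because x = (x - y) + y. Vanishing on the
    negative side keeps both summands nonnegative wherever the integrand is nonzero, so the
    extended-real product distributes. *)
Lemma timesid_convol f g : measurable_fun setT f -> measurable_fun setT g ->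
  (forall x, 0 <= f x) -> (forall x, 0 <= g x) ->
  (forall x, (x <= 0)%R -> f x = 0) -> (forall x, (x <= 0)%R -> g x = 0) ->
  timesid (convol f g) = convol (timesid f) g \+ convol f (timesid g).
Proof.
move=> mf mg f0 g0 fneg gneg; apply/funext => x.
have mfx := measurable_timesid mf; have mgx := measurable_timesid mg.
have fx0 := timesid_ge0 f0 fneg; have gx0 := timesid_ge0 g0 gneg.
rewrite /timesid [convol in RHS]lock /= -lock.
have [x0|x0] := leP x 0%R.
  rewrite !convol_neg ?mule0 ?adde0// => z z0; rewrite ?fneg ?gneg ?mule0//.
rewrite /convol -ge0_integralZl//; last 3 first.
- exact: measurable_convol_section.
- by move=> y _; exact: mule_ge0.
- by rewrite lee_fin ltW.
rewrite -ge0_integralD//; last 4 first.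
- by move=> y _; rewrite mule_ge0//; exact: fx0.
- exact: (@measurable_convol_section _ (timesid f)).
- by move=> y _; rewrite mule_ge0//; exact: gx0.
- exact: (@measurable_convol_section _ _ (timesid g)).
apply: eq_integral => y _; have [y0|y0] := leP y 0%R.
  by rewrite gneg// !mule0 adde0.
have [xy|xy] := leP (x - y)%R 0%R.
  by rewrite fneg// mule0 !mul0e mule0 adde0.
rewrite [f _ * (_ * _)]muleCA -muleA -ge0_muleDl ?lee_fin ?ltW// -EFinD.
by congr (_%:E * _); lra.
Qed.

End ConvolutionPositiveHalfLine.

Section RenewalDensity.
Context {R : realType}.
Local Notation mu := (@lebesgue_measure R).
Variables (k : R -> R) (r : R).
Hypothesis mk : measurable_fun setT k.
Hypothesis k_ge0 : forall x, 0 <= k x.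
Hypothesis k_neg : forall x : R, x <= 0 -> k x = 0.
Hypothesis k_noninc : forall x y : R, 0 < x -> x <= y -> k y <= k x.
Hypothesis int_k : (\int[mu]_x (k x)%:E = r%:E)%E.
Hypothesis r_lt1 : r < 1.

Let K := EFin \o k.

Let mK : measurable_fun setT K.
Proof. exact/measurable_EFinP. Qed.

Let K0 x : (0 <= K x)%E. Proof. by rewrite lee_fin. Qed.

Let Kneg x : x <= 0 -> K x = 0%E. Proof. by move=> x0; rewrite /K /= k_neg. Qed.

Let r_ge0 : 0 <= r.
Proof. by rewrite -lee_fin -int_k; apply: integral_ge0 => x _; exact: K0. Qed.

Let XK_ge0 := timesid_ge0 K0 Kneg.
Let mXK := measurable_timesid mK.

(* [x k(x) <= int_0^x k] because [k] is nonincreasing. *)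
Let XK_le x : (timesid K x <= r%:E)%E.
Proof.
rewrite /timesid; have [x0|x0] := leP x 0; first by rewrite Kneg// mule0 lee_fin.
rewrite -int_k.
apply: (@le_trans _ _ (\int[mu]_(y in `]0%R, x]) (k y)%:E)%E); last first.
  by apply: ge0_subset_integral => //= y _; rewrite lee_fin.
apply: (@le_trans _ _ (\int[mu]_(y in `]0%R, x]) (k x)%:E)%E).
  rewrite integral_cst//= lebesgue_measure_itv/= lte_fin x0 oppr0 adde0.
  by rewrite muleC.
apply: ge0_le_integral => //=.
- by move=> y _; rewrite lee_fin.
- exact: measurable_funTS.
- by move=> y /=; rewrite in_itv/= => /andP[y0 yx]; rewrite lee_fin k_noninc.
Qed.

Local Open Scope ereal_scope.

(** Partial sums of the convolution powers, in Horner form: the renewal equation for the limit is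
    then the limit of the recursion itself. *)
Fixpoint renewal_sum n : R -> \bar R :=
  if n is m.+1 then K \+ convol K (renewal_sum m) else cst 0.
Local Notation s := renewal_sum.

Let s_ge0 n x : 0 <= s n x.
Proof.
by elim: n x => //= n IH x; rewrite adde_ge0 ?K0//; exact: convol_ge0.
Qed.

Let ms n : measurable_fun setT (s n).
Proof.
by elim: n => [|n IH]/=; [exact: measurable_cst|apply: emeasurable_funD => //;
  exact: measurable_convol].
Qed.

Let s_neg n x : (x <= 0)%R -> s n x = 0.
Proof.
elim: n x => //= n IH x x0.
by rewrite Kneg// convol_neg ?adde0.
Qed.

Let s_nd : forall x, nondecreasing_seq (s ^~ x).
Proof.
move=> x; apply/nondecreasing_seqP => n; elim: n x => [|n IH] x.
  exact: s_ge0.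
rewrite /= leeD2l//; apply: ge0_le_integral => //=.
- by move=> y _; rewrite mule_ge0 ?s_ge0.
- exact: measurable_convol_section.
- exact: (@measurable_convol_section _ _ (s n.+1)).
- by move=> y _; rewrite lee_wpmul2l ?K0//; exact: IH.
Qed.

Let int_s n : \int[mu]_x s n x <= (r / (1 - r))%:E.
Proof.
have r1 : (0 < 1 - r)%R by rewrite subr_gt0.
elim: n => [|n IH]/=; first by rewrite integral0 lee_fin divr_ge0// ltW.
rewrite ge0_integralD//; last 2 first.
- by move=> x _; exact: convol_ge0.
- exact: measurable_convol.
rewrite integral_convol// [X in X + _]int_k [X in _ + X * _]int_k.
apply: (@le_trans _ _ (r%:E + r%:E * (r / (1 - r))%:E)).
  by rewrite leeD2l// lee_wpmul2l// lee_fin.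
by rewrite -EFinM -EFinD lee_fin le_eqVlt; apply/orP; left; apply/eqP; field;
  rewrite gt_eqF.
Qed.

(** The solution of B = r + r (r / (1 - r)) + B r. The three terms bound x K, (x K) * s_n and K * (x
    s_n), into which the derivation rule splits x s_(n+1). *)
Let B := (r / (1 - r) ^+ 2)%R.

Let Xs_le n x : timesid (s n) x <= B%:E.
Proof.
have r1 : (0 < 1 - r)%R by rewrite subr_gt0.
have B0 : (0 <= B)%R by rewrite divr_ge0// exprn_ge0// ltW.
elim: n x => [|n IH] x; first by rewrite /timesid/= mule0 lee_fin.
have -> : timesid (s n.+1) x = timesid K x + timesid (convol K (s n)) x.
  rewrite /timesid/=; have [x0|x0] := leP x 0%R.
    by rewrite Kneg// convol_neg ?adde0 ?mule0 ?adde0// => ?; exact: s_neg.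
  by rewrite ge0_muleDr// convol_ge0.
rewrite timesid_convol//=; last exact: s_neg.
have mXs := measurable_timesid (ms n).
have Xs0 := timesid_ge0 (s_ge0 n) (@s_neg n).
apply: (@le_trans _ _ (r%:E + (r%:E * (r / (1 - r))%:E + B%:E * r%:E))).
  apply: leeD; first exact: XK_le.
  apply: leeD.
    apply: (@le_trans _ _ (r%:E * \int[mu]_y s n y)).
      by apply: convol_le_sup => //; exact: XK_ge0.
    by rewrite lee_wpmul2l ?lee_fin.
  by rewrite convolC//= -int_k; exact: convol_le_sup.
rewrite -!EFinM -!EFinD lee_fin /B le_eqVlt; apply/orP; left; apply/eqP; field.
by rewrite gt_eqF.
Qed.

Definition renewal_density x := limn (s ^~ x).
Local Notation v := renewal_density.

Let s_cvg x : s ^~ x @ \oo --> v x.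
Proof. exact: ereal_nondecreasing_is_cvgn. Qed.

Let mv : measurable_fun setT v.
Proof. by apply: (emeasurable_fun_cvg _ _ ms) => x _; exact: s_cvg. Qed.

Let v_ge0 x : 0 <= v x.
Proof. by apply: lime_ge; [exact: ereal_nondecreasing_is_cvgn|exact: nearW]. Qed.

Let v_neg x : (x <= 0)%R -> v x = 0.
Proof.
move=> x0; apply/cvg_lim => //.
by under eq_fun do rewrite s_neg//; exact: cvg_cst.
Qed.

Let convol_s_cvg f x : measurable_fun setT f -> (forall y, 0 <= f y) ->
  convol f (s n) x @[n --> \oo] --> convol f v x.
Proof.
move=> mf f0.
have -> : convol f v x = \int[mu]_y limn (fun n => f (x - y)%R * s n y).
  apply: eq_integral => y _; apply/esym/cvg_lim => //.
  have := f0 (x - y)%R; case: (f (x - y)%R) => [a| |] a0 //.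
    exact: cvgeZl.
  (* Where the factor [f] is +oo the product is not continuous; there the sequence is either
     eventually +oo or constantly 0. *)
  have [sy|] := pselect (exists n, 0 < s n y).
    have [n ny] := sy; rewrite gt0_mulye; last first.
      apply: (lt_le_trans ny); apply: lime_ge.
        exact: ereal_nondecreasing_is_cvgn.
      by exists n => // m nm; exact: s_nd.
    apply: cvg_near_cst; exists n => // m nm /=.
    by rewrite gt0_mulye//; apply: (lt_le_trans ny); exact: s_nd.
  move/forallNP => sy; have sy0 n : s n y = 0.
    by apply/eqP; rewrite eq_le s_ge0 andbT leNgt; apply/negP.
  have -> : v y = 0 by apply/cvg_lim => //; under eq_fun do rewrite sy0;
    exact: cvg_cst.
  by under eq_fun do rewrite sy0; rewrite mule0; exact: cvg_cst.
apply: cvg_monotone_convergence => //.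
- by move=> n; exact: measurable_convol_section.
- by move=> n y _; rewrite mule_ge0 ?s_ge0.
- by move=> y _ a b ab; rewrite lee_wpmul2l//; exact: s_nd.
Qed.

Let vE : v = K \+ convol K v.
Proof.
apply/funext => x.
have /cvg_lim <- // : s n.+1 x @[n --> \oo] --> (K x + convol K v x).
  apply: cvgeD; [|exact: cvg_cst|exact: convol_s_cvg].
  by rewrite fin_num_adde_defr.
by rewrite /v; apply/esym/cvg_lim => //; rewrite (cvg_shiftS (s ^~ x)); exact: s_cvg.
Qed.

Let int_v_lty : \int[mu]_x v x <= (r / (1 - r))%:E.
Proof.
have cv : \int[mu]_x s n x @[n --> \oo] --> \int[mu]_x v x.
  by apply: cvg_monotone_convergence => // x _; exact: s_nd.
by apply: cvge_le cv; apply: nearW => n; exact: int_s.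
Qed.

Let Xv_le x : timesid v x <= B%:E.
Proof.
rewrite /timesid; have [x0|x0] := leP x 0%R.
  rewrite v_neg// mule0 lee_fin /B; apply: divr_ge0 => //.
  by apply: exprn_ge0; rewrite subr_ge0 ltW.
have cv : x%:E * s n x @[n --> \oo] --> x%:E * v x.
  by apply: cvgeZl => //; exact: s_cvg.
by apply: cvge_le cv; apply: nearW => n; exact: Xs_le.
Qed.

(** The weight e^(-a x) is multiplicative, so the weighted functions satisfy the renewal equation
    too. Integrating gives V = kap + kap V, which can be solved because V is at most the finite mass
    of [v] and kap <= r < 1. *)
Lemma integral_renewal_density a kap : (0 <= a)%R ->
  \int[mu]_x (expR (- (a * x)) * k x)%:E = kap%:E ->
  \int[mu]_x ((expR (- (a * x)))%:E * v x) = (kap / (1 - kap))%:E.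
Proof.
move=> a0 int_kap.
pose e x := expR (- (a * x)); pose Ke x := (e x * k x)%:E.
pose ve x := (e x)%:E * v x.
have e_le1 x : (0 < x)%R -> (e x <= 1)%R.
  by move=> x0; rewrite -expR0 ler_expR oppr_le0 mulr_ge0// ltW.
have e_ge0 x : (0 <= e x)%R by exact: expR_ge0.
have me : measurable_fun setT e.
  apply: measurableT_comp => //; apply: measurable_funN.
  exact: measurable_funM.
have Ke0 x : 0 <= Ke x by rewrite lee_fin mulr_ge0.
have ve0 x : 0 <= ve x by rewrite mule_ge0// lee_fin.
have mKe : measurable_fun setT Ke by apply/measurable_EFinP; exact: measurable_funM.
have mve : measurable_fun setT ve.
  by apply: emeasurable_funM => //; exact/measurable_EFinP.
have veE : ve = Ke \+ convol Ke ve.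
  apply/funext => x; rewrite /ve {1}vE /= ge0_muleDr ?convol_ge0//.
  congr (_ + _); rewrite /convol -ge0_integralZl//; last 3 first.
  - exact: measurable_convol_section.
  - by move=> y _; rewrite mule_ge0// lee_fin.
  - by rewrite lee_fin.
  apply: eq_integral => y _; rewrite /Ke /ve /K /= !muleA -!EFinM.
  congr (_%:E * _); have -> : e x = (e (x - y) * e y)%R.
    by rewrite /e -expRD; congr expR; ring.
  by ring.
have ve_fin : \int[mu]_x ve x \is a fin_num.
  rewrite ge0_fin_numE ?integral_ge0//.
  apply: (@le_lt_trans _ _ (\int[mu]_x v x)); last first.
    exact: le_lt_trans int_v_lty (ltry _).
  apply: ge0_le_integral => // x _; rewrite /ve.
  have [x0|x0] := leP x 0%R; first by rewrite v_neg// mule0.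
  by rewrite -[leRHS]mul1e lee_wpmul2r// lee_fin e_le1.
have kap_le : (kap <= r)%R.
  rewrite -lee_fin -int_kap -int_k; apply: ge0_le_integral => //.
  - by move=> x _; exact: Ke0.
  - move=> x _; rewrite lee_fin.
    have [x0|x0] := leP x 0%R; first by rewrite k_neg// mulr0.
    by rewrite -[leRHS]mul1r ler_wpM2r// e_le1.
have : \int[mu]_x ve x = kap%:E + kap%:E * \int[mu]_x ve x.
  rewrite {1}veE ge0_integralD//; last 2 first.
  - by move=> x _; exact: convol_ge0.
  - exact: measurable_convol.
  by rewrite integral_convol// (int_kap : \int[mu]_x Ke x = _).
rewrite -(fineK ve_fin) -EFinM -EFinD => -[E].
rewrite -/(ve _) -(fineK ve_fin); congr EFin.
have kap1 : (1 - kap != 0)%R by rewrite subr_eq0 gt_eqF// (le_lt_trans kap_le).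
apply: (mulIf kap1); rewrite divfK// mulrBr mulr1 [X in (X - _)%R]E; ring.
Qed.

(** Pointwise |k(x+h) - k(x)| + k(x+h) = k(x) + 2 k1(x+h), where [k1] is k restricted to ]0, h]: for
    x > 0 the increment is nonpositive, for -h < x <= 0 only k(x+h) survives. Integrating over the
    line, the mass r cancels on both sides. *)
Let shift_L1 (h : R) : (0 < h)%R ->
  \int[mu]_x `|k (x + h) - k x|%:E <= 2%:E * \int[mu]_(x in `]0%R, h]) (k x)%:E.
Proof.
move=> h0.
have mkh : measurable_fun setT (fun x : R => k (x + h)%R).
  by apply: measurableT_comp => //; exact: measurable_funD.
pose k1 x := (k x * \1_(`]0, h]%classic : set R) x)%R.
have mk1 : measurable_fun setT k1.
  by apply: measurable_funM => //; exact: measurable_indic.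
have k1_ge0 x : (0 <= k1 x)%R by rewrite mulr_ge0.
have int_k1 : \int[mu]_(x in `]0%R, h]) (k x)%:E = \int[mu]_x (k1 (x + h)%R)%:E.
  rewrite (@ge0_integral_shift _ (EFin \o k1))//; last exact/measurable_EFinP.
  rewrite integral_mkcond; apply: eq_integral => x _.
  by rewrite /= /k1 patchE indicE; case: ifPn => _; rewrite ?mulr1 ?mulr0.
have int_kh : \int[mu]_x (k (x + h))%:E = r%:E.
  by rewrite (@ge0_integral_shift _ K).
have : \int[mu]_x `|k (x + h) - k x|%:E + r%:E =
    r%:E + 2%:E * \int[mu]_x (k1 (x + h)%R)%:E.
  have m1 : measurable_fun setT (fun x : R => (k1 (x + h)%R)%:E).
    by apply/measurable_EFinP; apply: measurableT_comp => //; exact: measurable_funD.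
  have m2 : measurable_fun setT (fun x : R => `|k (x + h) - k x|%:E).
    by apply/measurable_EFinP; apply: measurableT_comp => //; exact: measurable_funB.
  have m3 : measurable_fun setT (fun x : R => (k (x + h))%:E) by exact/measurable_EFinP.
  rewrite -{1}int_kh -int_k -ge0_integralZl//; last by move=> x _; rewrite lee_fin.
  have m4 := @measurable_funeM _ _ _ setT _ 2%:E m1.
  have k10 x : 0 <= 2%:E * (k1 (x + h)%R)%:E by rewrite mule_ge0// lee_fin.
  rewrite -ge0_integralD//; last by move=> x _; rewrite lee_fin.
  rewrite -ge0_integralD//; last by move=> x _; rewrite lee_fin.
  apply: eq_integral => x _; rewrite -EFinM -!EFinD; congr EFin.
  rewrite /k1 indicE; have [x0|x0] := leP x 0%R.
    rewrite [k x]k_neg// subr0 ger0_norm// add0r.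
    have [xh|xh] := leP (x + h)%R 0%R.
      by rewrite k_neg// add0r mul0r mulr0.
    rewrite mem_set ?mulr1; first by ring.
    by rewrite /= in_itv/= xh /= -lerBrDr subrr.
  have kk : (k (x + h) <= k x)%R by apply: k_noninc => //; rewrite lerDl ltW.
  rewrite memNset ?mulr0 ?addr0; last first.
    by rewrite /= in_itv/= => /andP[_]; rewrite -lerBrDr subrr leNgt x0.
  by rewrite ler0_norm ?subr_le0//; ring.
move=> /(congr1 (fun z => z - r%:E)); rewrite addeK// addeAC subee// add0e => ->.
by rewrite int_k1.
Qed.

(** [D] is M times the L^1 bound of [shift_L1] for the shift y - x. Two inequalities with sums stand
    for the absolute value of a difference, as finiteness of the convolutions is not yet known. *)
Let convol_shift_le (b : R -> R) (M x y : R) : (x < y)%R ->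
  measurable_fun setT b -> (forall z, 0 <= b z <= M)%R ->
  let D := M%:E * (2%:E * \int[mu]_(t in `]0%R, (y - x)%R]) (k t)%:E) in
  convol K (EFin \o b) y <= convol K (EFin \o b) x + D /\
  convol K (EFin \o b) x <= convol K (EFin \o b) y + D.
Proof.
move=> xy mb bM D.
have M0 : (0 <= M)%R by have /andP[] := bM 0%R; exact: le_trans.
have b0 z : (0 <= b z)%R by have /andP[] := bM z.
have bleM z : (b z <= M)%R by have /andP[] := bM z.
have my z : measurable_fun setT (fun t : R => k (z - t)%R).
  by apply: measurableT_comp => //; exact: measurable_fun_subl.
pose d z := (`|k (y - z) - k (x - z)|)%R.
have d0 z : (0 <= d z)%R by exact: normr_ge0.
have md : measurable_fun setT d.
  by apply: measurableT_comp => //; exact: measurable_funB.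
have dD : \int[mu]_z (d z * b z)%:E <= D.
  apply: (@le_trans _ _ (\int[mu]_z (M%:E * (d z)%:E))).
    apply: ge0_le_integral => //.
    - by move=> z _; rewrite lee_fin mulr_ge0.
    - by apply/measurable_EFinP; exact: measurable_funM.
    - by apply/measurable_EFinP; exact: measurable_funM.
    - by move=> z _; rewrite -EFinM lee_fin mulrC ler_wpM2r.
  rewrite ge0_integralZl//; last 2 first.
  - exact/measurable_EFinP.
  - by move=> z _; rewrite lee_fin.
  rewrite lee_wpmul2l ?lee_fin//.
  have := @shift_L1 (y - x) _; rewrite subr_gt0 => /(_ xy); apply: le_trans.
  rewrite -(@ge0_integral_reflect _ (fun z => `|k (z + (y - x))%R - k z|%:E) x)//; last first.
    apply/measurable_EFinP; apply: measurableT_comp => //; apply: measurable_funB => //.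
    by apply: measurableT_comp => //; exact: measurable_funD.
  rewrite le_eqVlt; apply/orP; left; apply/eqP; apply: eq_integral => z _.
  by rewrite /d; congr (`|k _ - _|%:E); ring.
have step (u w : R) : (forall z, k (u - z) <= k (w - z) + d z)%R ->
    convol K (EFin \o b) u <= convol K (EFin \o b) w + D.
  move=> kd; apply: le_trans (leeD2l _ dD).
  rewrite /convol -ge0_integralD//; last 4 first.
  - by move=> z _; rewrite mule_ge0// lee_fin.
  - by apply: measurable_convol_section => //; exact/measurable_EFinP.
  - by move=> z _; rewrite lee_fin mulr_ge0.
  - by apply/measurable_EFinP; exact: measurable_funM.
  apply: ge0_le_integral => //.
  - by move=> z _; rewrite mule_ge0// lee_fin.
  - by apply: measurable_convol_section => //; exact/measurable_EFinP.
  - apply: emeasurable_funD.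
      by apply: measurable_convol_section => //; exact/measurable_EFinP.
    by apply/measurable_EFinP; exact: measurable_funM.
  - move=> z _; rewrite /K /= -!EFinM -EFinD lee_fin -mulrDl.
    by rewrite ler_wpM2r.
split; apply: step => z; rewrite /d.
  by rewrite -lerBlDl ler_norm.
by rewrite -lerBlDl distrC ler_norm.
Qed.

Let continuous_convol (b : R -> R) (M : R) :
  measurable_fun setT b -> (forall z, 0 <= b z <= M)%R ->
  exists2 c : R -> R, continuous c & convol K (EFin \o b) = EFin \o c.
Proof.
move=> mb bM.
have M0 : (0 <= M)%R by have /andP[] := bM 0%R; exact: le_trans.
have b0 z : (0 <= b z)%R by have /andP[] := bM z.
have bleM z : (b z <= M)%R by have /andP[] := bM z.
have mB : measurable_fun setT (EFin \o b) by exact/measurable_EFinP.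
have cfin x : convol K (EFin \o b) x \is a fin_num.
  rewrite ge0_fin_numE; last by apply: convol_ge0 => // z; rewrite lee_fin.
  apply: (@le_lt_trans _ _ (M%:E * \int[mu]_z K z)); last first.
    by rewrite /K [X in _ * X]int_k -EFinM ltry.
  rewrite convolC//.
  by apply: convol_le_sup => // z; rewrite lee_fin.
exists (fine \o convol K (EFin \o b)); last first.
  by apply/funext => x /=; rewrite fineK.
have intk : mu.-integrable setT (EFin \o k).
  apply/integrableP; split; first exact/measurable_EFinP.
  under eq_integral do rewrite gee0_abs ?K0//.
  by rewrite [X in X < _]int_k ltry.
have mod (e : R) : (0 < e)%R -> exists2 d : R, (0 < d)%R & forall x y, (x < y < x + d)%R ->
    (`|fine (convol K (EFin \o b) x) - fine (convol K (EFin \o b) y)| <= e)%R.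
  move=> e0.
  (* [M + 1] because [M] may be 0; the factor 2 is the one in [shift_L1]. The radius then comes from
     absolute continuity of the integral of [k]. *)
  have e1 : (0 < e / (2 * (M + 1)))%R by rewrite divr_gt0// mulr_gt0// ltr_wpDl.
  have [d [d0 dP]] := integral_normr_continuous intk e1.
  exists d => // x y /andP[xy yd].
  have [] := @convol_shift_le b M x y xy mb bM.
  set I := \int[mu]_(t in _) _.
  have Ifin : I \is a fin_num.
    rewrite ge0_fin_numE; last by apply: integral_ge0 => t _; rewrite lee_fin.
    apply: (@le_lt_trans _ _ (\int[mu]_t (k t)%:E)); last by rewrite int_k ltry.
    by apply: ge0_subset_integral => // t _; rewrite lee_fin.
  have Ie : (fine I < e / (2 * (M + 1)))%R.
    have muI : mu `]0%R, (y - x)%R]%classic < d%:E.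
      by rewrite lebesgue_measure_itv/= lte_fin subr_gt0 xy oppr0 adde0 lte_fin ltrBlDl.
    have := dP _ (measurable_itv _) muI; rewrite /Rintegral.
    by under eq_integral do rewrite ger0_norm//.
  rewrite -(fineK (cfin x)) -(fineK (cfin y)) -(fineK Ifin) -!EFinM -!EFinD !lee_fin.
  have De : (M * (2 * fine I) <= e)%R.
    apply: (@le_trans _ _ ((M + 1) * (2 * (e / (2 * (M + 1)))))%R).
      apply: ler_pM => //; rewrite ?mulr_ge0 ?fine_ge0 ?integral_ge0//.
      - by move=> t _; rewrite lee_fin.
      - by rewrite lerDl.
      - by rewrite ler_pM2l// ltW.
    rewrite le_eqVlt; apply/orP; left; apply/eqP; field.
    by rewrite gt_eqF// ltr_wpDl.
  by move=> h1 h2; rewrite ler_norml; apply/andP; split; lra.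
move=> x; apply/cvgrPdist_le => /= e e0; have [d d0 dP] := mod _ e0.
near=> y; have [xy|yx|->] := ltgtP x y.
- apply: dP; rewrite xy/= -ltrBlDl; near: y.
  have : \forall y \near x, (`|x - y| < d)%R by apply: (@nbhsx_ballx _ _ x d).
  by apply: filterS => y; apply: le_lt_trans; rewrite distrC ler_norm.
- rewrite distrC; apply: dP; rewrite yx/= -ltrBlDl; near: y.
  have : \forall y \near x, (`|x - y| < d)%R by apply: (@nbhsx_ballx _ _ x d).
  by apply: filterS => y; apply: le_lt_trans; rewrite ler_norm.
- by rewrite subrr normr0 ltW.
Unshelve. all: by end_near. Qed.

(** [w] is the real-valued [v], and c = x (k * v). The derivation rule gives (x k) * v + k * (x v).
    The shift estimate is available for the monotone [k] but not for [v], so in the first term [v]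
    is replaced once by k + k * v: every term then has a factor [k] in front, convolved with the
    bounded function [b0]. *)
Lemma renewal_density_split : exists w c : R -> R,
  [/\ measurable_fun setT w,
      forall x, (0 <= w x)%R /\ (x <= 0 -> w x = 0)%R,
      forall a kap, (0 <= a)%R ->
        \int[mu]_x (expR (- (a * x)) * k x)%:E = kap%:E ->
        \int[mu]_x (expR (- (a * x)) * w x)%:E = (kap / (1 - kap))%:E,
      continuous c & forall x : R, (0 < x)%R -> w x = (k x + c x / x)%R].
Proof.
have vfin x : v x \is a fin_num.
  have [x0|x0] := leP x 0%R; first by rewrite v_neg.
  rewrite ge0_fin_numE// ltey; apply/negP => /eqP vx.
  by have := Xv_le x; rewrite /timesid vx gt0_muley ?lte_fin// leNgt ltry.
have mXv := measurable_timesid mv.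
have Xv0 := timesid_ge0 v_ge0 v_neg.
pose b0 := timesid K \+ (convol (timesid K) v \+ timesid v).
(* Its three terms bound x k, (x k) * v and x v. *)
pose M := (r + (r * (r / (1 - r)) + B))%R.
have mXKv : measurable_fun setT (convol (timesid K) v) by exact: measurable_convol.
have XKv0 x : 0 <= convol (timesid K) v x by exact: convol_ge0.
have b0M x : 0 <= b0 x <= M%:E.
  apply/andP; split.
    apply: adde_ge0; first exact: XK_ge0.
    by apply: adde_ge0; [exact: XKv0|exact: Xv0].
  rewrite !EFinD; apply: leeD => //; apply: leeD => //.
  apply: (@le_trans _ _ (r%:E * \int[mu]_y v y)); first exact: convol_le_sup.
  by rewrite EFinM lee_wpmul2l ?lee_fin.
have b0fin x : b0 x \is a fin_num.
  by have /andP[? bM] := b0M x; rewrite ge0_fin_numE// (le_lt_trans bM)// ltry.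
have b0E : b0 = EFin \o (fine \o b0).
  by apply/funext => x /=; rewrite fineK.
have mb0 : measurable_fun setT b0.
  by apply: emeasurable_funD => //; exact: emeasurable_funD.
have [||c cc cE] := @continuous_convol (fine \o b0) M.
- exact: measurableT_comp.
- by move=> z; have := b0M z; rewrite -(fineK (b0fin z)) !lee_fin.
have Xv : timesid (convol K v) = EFin \o c.
  rewrite -cE -b0E timesid_convol// /b0 convolD//; last 2 first.
  - exact: emeasurable_funD.
  - by move=> x; rewrite adde_ge0.
  rewrite [convol K (convol _ _ \+ _)]convolD//.
  rewrite {1}vE convolD//; last 2 first.
  - exact: measurable_convol.
  - by move=> x; exact: convol_ge0.
  rewrite (@convolC _ (timesid K) K)// (@convolCA _ (timesid K) K)//.
  by apply/funext => x; rewrite -addeA.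
exists (fine \o v), c; split => //.
- exact: measurableT_comp.
- by move=> x /=; split=> [|x0]; [exact/fine_ge0/v_ge0|rewrite v_neg].
- move=> a kap a0 /(integral_renewal_density a0) <-.
  by apply: eq_integral => x _; rewrite EFinM /= fineK.
move=> x x0 /=; have : (x%:E * convol K v x) = (c x)%:E by have := congr1 (@^~ x) Xv.
have Kvfin : convol K v x \is a fin_num.
  rewrite ge0_fin_numE ?convol_ge0//; apply: le_lt_trans (_ : _ <= v x) _.
    by rewrite {2}vE leeDr.
  by rewrite -ge0_fin_numE.
rewrite -(fineK Kvfin) -EFinM => -[<-].
by rewrite {1}vE /= fineD//; congr (_ + _)%R; rewrite mulrAC divff ?mul1r ?gt_eqF.
Qed.

End RenewalDensity.

(** * Uniqueness of Laplace transforms *)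

Section LaplaceUniqueness.
Context {R : realType}.
Local Notation mu := (@lebesgue_measure R).

Lemma bernoulli_ge (a : R) n : 0 <= a <= 1 -> 1 - n%:R * a <= (1 - a) ^+ n.
Proof.
move=> /andP[a0 a1]; elim: n => [|n IH]; first by rewrite mul0r subr0 expr0.
rewrite exprS -nat1r; apply: (@le_trans _ _ ((1 - a) * (1 - n%:R * a))).
  have : 0 <= n%:R * a * a by rewrite !mulr_ge0.
  by lra.
by rewrite ler_wpM2l// subr_ge0.
Qed.

(* An exponential polynomial in [x] tending to the indicator of [x > t]. *)
Definition laplace_cutoff (t : R) n (x : R) :=
  (1 - expR (- (n%:R * (ln 2 / t) * x))) ^+ (2 ^ n).

Lemma laplace_cutoff_itv (t : R) n (x : R) : 0 < t -> 0 <= x ->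
  0 <= laplace_cutoff t n x <= 1.
Proof.
move=> t0 x0; rewrite /laplace_cutoff; set e := expR _.
have e1 : e <= 1.
  rewrite -expR0 ler_expR oppr_le0 !mulr_ge0// ?invr_ge0 ?ltW// ln_gt0//.
  by rewrite ltr1n.
have e0 : 0 < e by exact: expR_gt0.
by apply/andP; split; [rewrite exprn_ge0//|rewrite exprn_ile1//]; lra.
Qed.

(** The cutoff is (1 - y / 2^n)^(2^n) with y = e^(n b) and b = ln 2 (1 - x / t), whose sign tells x
    < t from x > t. It lies below e^(-y) and, by Bernoulli, above 1 - y; the inequality e^u >= 1 + u
    turns both bounds into the common rate 1 / (1 + n |b|). *)
Lemma laplace_cutoff_cvg (t x : R) : 0 < t -> 0 <= x -> x != t ->
  laplace_cutoff t n x @[n --> \oo] --> ((t < x)%R%:R : R).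
Proof.
move=> t0 x0 xt.
have ln20 : 0 < ln 2 :> R by rewrite ln_gt0 ?ltr1n.
pose b := ln 2 * (1 - x / t).
have b0 : 0 < `|b|.
  rewrite normr_gt0 /b mulf_eq0 negb_or gt_eqF//= subr_eq0.
  apply: contraNneq xt => E; apply/eqP.
  by rewrite -[t]mul1r E divfK// gt_eqF.
have yE n : (2 ^ n)%:R * expR (- (n%:R * (ln 2 / t) * x)) = expR (n%:R * b).
  have -> : (2 ^ n)%:R = expR (n%:R * ln 2) :> R.
    by rewrite natrX expRM_natl lnK// posrE.
  rewrite -expRD; congr expR; rewrite /b; field.
  by rewrite gt_eqF.
have n0 n : 0 < 1 + n%:R * `|b| by rewrite ltr_wpDr// mulr_ge0.
have cv0 : (1 + n%:R * `|b|)^-1 @[n --> \oo] --> (0 : R).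
  apply/cvgrPdist_le => /= e e0; near=> n.
  rewrite sub0r normrN ger0_norm; last by rewrite invr_ge0 ltW.
  rewrite invf_ple ?posrE ?n0//.
  apply: (@le_trans _ _ (n%:R * `|b|)); last by rewrite lerDr.
  rewrite -ler_pdivrMr//; near: n; exact: nbhs_infty_ger.
have a01 n : 0 <= expR (- (n%:R * (ln 2 / t) * x)) <= 1.
  by rewrite expR_ge0 -[leRHS]expR0 ler_expR oppr_le0 !mulr_ge0// ?invr_ge0 ltW.
have [xlt|tlt|xt'] := ltgtP x t; last by rewrite xt' eqxx in xt.
- have bpos : 0 < b by rewrite mulr_gt0// subr_gt0 ltr_pdivrMr// mul1r.
  rewrite -[false%:R]/(0 : R).
  apply: (squeeze_cvgr _ (cvg_cst 0) cv0); apply: nearW => n.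
  have /andP[-> _] /= := laplace_cutoff_itv n t0 x0.
  apply: (@le_trans _ _ (expR (- expR (n%:R * b)))).
    rewrite -yE -mulrN expRM_natl /laplace_cutoff lerXn2r ?nnegrE ?expR_ge0//.
      by rewrite subr_ge0; have /andP[] := a01 n.
    exact: expR_ge1Dx.
  rewrite expRN lef_pV2 ?posrE ?expR_gt0 ?n0//.
  rewrite (gtr0_norm bpos); apply: (@le_trans _ _ (expR (n%:R * b))).
    exact: expR_ge1Dx.
  by apply: le_trans (expR_ge1Dx _); rewrite lerDr.
- have bneg : b < 0 by rewrite pmulr_rlt0// subr_lt0 ltr_pdivlMr// mul1r.
  have cv1 : 1 - (1 + n%:R * `|b|)^-1 @[n --> \oo] --> (1 : R).
    by rewrite -[X in _ --> X]subr0; apply: cvgB => //; exact: cvg_cst.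
  rewrite -[true%:R]/(1 : R).
  apply: (squeeze_cvgr _ cv1 (cvg_cst (1 : R))); apply: nearW => n.
  have /andP[_ ->] := laplace_cutoff_itv n t0 x0; rewrite andbT.
  apply: le_trans (bernoulli_ge _ (a01 n)); rewrite yE lerD2l lerN2.
  rewrite -[n%:R * b]opprK expRN lef_pV2 ?posrE ?expR_gt0 ?n0//.
  by rewrite -mulrN -(ltr0_norm bneg) expR_ge1Dx.
Unshelve. all: by end_near. Qed.

Section Unique.
Variables (f g : R -> R) (s0 : R).
Let D : set R := `[0, +oo[%classic.
Hypotheses (mf : measurable_fun setT f) (mg : measurable_fun setT g).
Hypotheses (f_ge0 : forall x, 0 <= f x) (g_ge0 : forall x, 0 <= g x).
Hypothesis f_lty : forall s, s0 < s ->
  (\int[mu]_(x in D) (expR (- (s * x)) * f x)%:E < +oo)%E.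
Hypothesis fg : forall s, s0 < s ->
  (\int[mu]_(x in D) (expR (- (s * x)) * f x)%:E =
   \int[mu]_(x in D) (expR (- (s * x)) * g x)%:E)%E.

Let mD : measurable D. Proof. exact: measurable_itv. Qed.

Let pw (b : R) n s (h : R -> R) x :=
  (1 - expR (- (b * x))) ^+ n * (expR (- (s * x)) * h x).

Let mexp (s : R) : measurable_fun setT (fun x : R => expR (- (s * x))).
Proof.
by apply: measurableT_comp => //; apply: measurable_funN; exact: measurable_funM.
Qed.

Let mw s (h : R -> R) : measurable_fun setT h ->
  measurable_fun D (fun x : R => (expR (- (s * x)) * h x)%:E).
Proof.
move=> mh; apply/measurable_EFinP/measurable_funTS.
by apply: measurable_funM => //; exact: mexp.
Qed.

Let mpw b n s (h : R -> R) : measurable_fun setT h -> measurable_fun setT (pw b n s h).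
Proof.
move=> mh; apply: measurable_funM.
  by apply: measurable_funX; apply: measurable_funB.
exact: measurable_funM.
Qed.

Let pw_norm b n s (h : R -> R) x : 0 <= b -> (forall x, 0 <= h x) -> D x ->
  `|pw b n s h x| <= expR (- (s * x)) * h x.
Proof.
rewrite /D /= in_itv/= andbT => b0 h0 x0.
rewrite normrM [X in _ * X]ger0_norm ?mulr_ge0 ?expR_ge0//.
rewrite -[leRHS]mul1r ler_wpM2r ?mulr_ge0 ?expR_ge0//.
rewrite normrX exprn_ile1// ger0_norm; first by rewrite gerBl expR_ge0.
by rewrite subr_ge0 -expR0 ler_expR oppr_le0 mulr_ge0.
Qed.

Let pw_integrable (b : R) n s (h : R -> R) : 0 <= b -> measurable_fun setT h ->
  (forall x, 0 <= h x) ->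
  (\int[mu]_(x in D) (expR (- (s * x)) * h x)%:E < +oo)%E ->
  mu.-integrable D (EFin \o pw b n s h).
Proof.
move=> b0 mh h0 hoo; apply/integrableP; split.
  by apply/measurable_EFinP/measurable_funTS; exact: mpw.
apply: le_lt_trans hoo; apply: ge0_le_integral => //.
- apply: measurableT_comp => //.
  by apply/measurable_EFinP/measurable_funTS; exact: mpw.
- exact: mw.
- by move=> x Dx; rewrite lee_fin; exact: pw_norm.
Qed.

(** Expanding one factor 1 - e^(-b x) lowers the power and moves s to s + b, which is still above
    [s0]. Induction for all s at once replaces the binomial expansion. *)
Let pw_eq (b : R) n s : 0 <= b -> s0 < s ->
  (\int[mu]_(x in D) (pw b n s f x)%:E = \int[mu]_(x in D) (pw b n s g x)%:E)%E.
Proof.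
move=> b0; elim: n s => [|n IH] s ss0.
  by have := fg ss0; under eq_integral do rewrite -[_ * _]mul1r;
     under [in RHS]eq_integral do rewrite -[_ * _]mul1r.
have ssb : s0 < s + b by rewrite ltr_wpDr.
have pwS h x : pw b n.+1 s h x = pw b n s h x - pw b n (s + b) h x.
  rewrite /pw exprSr mulrDl opprD expRD; ring.
have step (h : R -> R) : measurable_fun setT h -> (forall x, 0 <= h x) ->
    (forall s, s0 < s -> (\int[mu]_(x in D) (expR (- (s * x)) * h x)%:E < +oo)%E) ->
    (\int[mu]_(x in D) (pw b n.+1 s h x)%:E =
     \int[mu]_(x in D) (pw b n s h x)%:E -
     \int[mu]_(x in D) (pw b n (s + b) h x)%:E)%E.
  move=> mh h0 hoo; rewrite -integralB//; last 2 first.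
  - by apply: pw_integrable => //; exact: hoo.
  - by apply: pw_integrable => //; exact: hoo.
  by apply: eq_integral => x _; rewrite pwS EFinB.
rewrite !step//; first by rewrite !IH.
by move=> z sz; rewrite -fg//; exact: f_lty.
Qed.

(** With b = n ln 2 / t and power 2^n, [pw] is the cutoff times the weighted function. The cutoffs
    are bounded by 1 and converge off the null set {t}, so dominated convergence applies. *)
Let tail_eq (t : R) : 0 < t ->
  (\int[mu]_(x in `]t, +oo[) (expR (- ((s0 + 1) * x)) * f x)%:E =
   \int[mu]_(x in `]t, +oo[) (expR (- ((s0 + 1) * x)) * g x)%:E)%E.
Proof.
move=> t0; set s := s0 + 1.
have ss0 : s0 < s by rewrite ltrDl.
have cv (h : R -> R) : measurable_fun setT h -> (forall x, 0 <= h x) ->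
    (\int[mu]_(x in D) (expR (- (s * x)) * h x)%:E < +oo)%E ->
    (\int[mu]_(x in D) (pw (n%:R * (ln 2 / t)) (2 ^ n) s h x)%:E @[n --> \oo] -->
     \int[mu]_(x in `]t, +oo[) (expR (- (s * x)) * h x)%:E)%E.
  move=> mh h0 hoo.
  have b0 n : 0 <= n%:R * (ln 2 / t) :> R.
    by rewrite mulr_ge0// divr_ge0 ?ln_ge0 ?ler1n ?ltW.
  have -> : (\int[mu]_(x in `]t, +oo[) (expR (- (s * x)) * h x)%:E =
    \int[mu]_(x in D) ((t < x)%R%:R * (expR (- (s * x)) * h x))%:E)%E.
    rewrite integral_mkcond [RHS]integral_mkcond; apply: eq_integral => x _.
    rewrite !patchE !mem_setE !in_itv/= !andbT.
    have [xt|xt] := ltP t x; rewrite ?mul1r ?mul0r; last by case: ifP.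
    by rewrite (le_trans (ltW t0) (ltW xt)).
  have [] := @dominated_convergence _ _ _ mu D _
    (fun n x => (pw (n%:R * (ln 2 / t)) (2 ^ n) s h x)%:E)
    (fun x => ((t < x)%R%:R * (expR (- (s * x)) * h x))%:E)
    (fun x => (expR (- (s * x)) * h x)%:E) => //.
  - by move=> n; apply/measurable_EFinP/measurable_funTS; exact: mpw.
  - apply/measurable_EFinP/measurable_funTS; apply: measurable_funM.
      by apply: measurableT_comp => //; exact: measurable_fun_ltr.
    by apply: measurable_funM => //; exact: mexp.
  - exists [set t]; split => //; first exact: lebesgue_measure_set1.
    move=> x /= /not_implyP[Dx] ncv; apply: contrapT => /eqP xt; apply: ncv.
    apply: cvg_EFin; first exact: nearW.
    apply: cvgMl; apply: laplace_cutoff_cvg => //.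
    by move: Dx; rewrite /D /= in_itv/= andbT.
  - apply/integrableP; split.
      exact: mw.
    under eq_integral do rewrite gee0_abs ?lee_fin ?mulr_ge0 ?expR_ge0//.
    exact: hoo.
  - by apply: aeW => x n Dx; rewrite lee_fin; exact: pw_norm.
have E : (fun n => \int[mu]_(x in D) (pw (n%:R * (ln 2 / t)) (2 ^ n) s f x)%:E)%E =
    (fun n => \int[mu]_(x in D) (pw (n%:R * (ln 2 / t)) (2 ^ n) s g x)%:E)%E.
  apply/funext => n; apply: pw_eq => //.
  by rewrite mulr_ge0// divr_ge0 ?ln_ge0 ?ler1n ?ltW.
have goo : (\int[mu]_(x in D) (expR (- (s * x)) * g x)%:E < +oo)%E.
  by rewrite -fg//; exact: f_lty.
have := cv g mg g_ge0 goo; rewrite -E => cg.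
exact: cvg_unique (cv f mf f_ge0 (f_lty ss0)) cg.
Qed.

(** Equal tails give equal integrals of the weighted functions over [a, y] for every y, and the
    derivative in y at a continuity point recovers the value. The base point must satisfy 0 < a < x,
    whence x / 2. *)
Lemma laplace_unique (x : R) : 0 < x -> {for x, continuous f} ->
  {for x, continuous g} -> f x = g x.
Proof.
move=> x0 cf cg; set s := s0 + 1.
have ss0 : s0 < s by rewrite ltrDl.
pose w (h : R -> R) (y : R) := expR (- (s * y)) * h y.
have ih (h : R -> R) : measurable_fun setT h -> (forall x, 0 <= h x) ->
    (\int[mu]_(x in D) (expR (- (s * x)) * h x)%:E < +oo)%E ->
    mu.-integrable D (EFin \o w h).
  move=> mh h0 hoo; apply/integrableP; split.
    exact: mw.
  by under eq_integral do rewrite gee0_abs ?lee_fin ?mulr_ge0 ?expR_ge0//.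
have iwf : mu.-integrable D (EFin \o w f) by apply: ih => //; exact: f_lty.
have iwg : mu.-integrable D (EFin \o w g).
  by apply: ih => //; rewrite -fg//; exact: f_lty.
pose a := x / 2.
have a0 : 0 < a by rewrite divr_gt0.
have ax : a < x by rewrite ltr_pdivrMr// ltr_pMr// ltr1n.
have sub (u : R) : `[a, u] `<=` D.
  by move=> z; rewrite /D /= !in_itv/= andbT => /andP[az _]; rewrite (le_trans _ az)// ltW.
have suboo : `[a, +oo[ `<=` D.
  by move=> z; rewrite /D /= !in_itv/= !andbT; apply: le_trans; exact: ltW.
have der (h : R -> R) : measurable_fun setT h -> mu.-integrable D (EFin \o w h) ->
    {for x, continuous h} ->
    derive1 (fun y => \int[mu]_(z in [set` `[a, y]]) w h z) x = w h x.
  move=> mh iwh ch.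
  have [] := @continuous_FTC1_closed _ (w h) a x (x + 1) _ _ ax _ => //.
  - by rewrite ltrDl.
  - exact: integrableS iwh.
  - apply: continuousM => //; apply: continuous_comp; last exact: continuous_expR.
    by apply: continuousN; exact: mulrl_continuous.
have : w f x = w g x.
  rewrite -der// -[RHS]der//; congr (derive1 _ x); apply/funext => y.
  have [ya|ay] := ltP y a.
    by rewrite set_itv_ge ?Rintegral_set0// bnd_simp -ltNge.
  have E h : mu.-integrable D (EFin \o w h) ->
      \int[mu]_(z in [set` `[a, y]]) w h z = \int[mu]_(z in `[a, +oo[) w h z -
        \int[mu]_(z in `]y, +oo[) w h z.
    move=> iwh; rewrite -(@Rintegral_itvB _ _ (BLeft a) +oo%O y) ?bnd_simp//.
      by rewrite subKr.
    exact: integrableS iwh.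
  have y0 : 0 < y by exact: lt_le_trans a0 ay.
  rewrite !E//; congr (_ - _); rewrite /Rintegral.
    rewrite -!integral_itv_obnd_cbnd; last 2 first.
    - apply/measurable_EFinP/measurable_funTS; exact: measurable_funM.
    - apply/measurable_EFinP/measurable_funTS; exact: measurable_funM.
    by rewrite tail_eq.
  by rewrite tail_eq.
by rewrite /w; apply: mulfI; rewrite gt_eqF// expR_gt0.
Qed.

End Unique.
End LaplaceUniqueness.

(** * Laplace transforms of primitives *)

Section ExponentialIntegrals.
Context {R : realType}.
Local Notation mu := (@lebesgue_measure R).

Lemma measurable_expRN (s : R) : measurable_fun setT (fun x : R => expR (- (s * x))).
Proof.
by apply: measurableT_comp => //; apply: measurable_funN; exact: measurable_funM.
Qed.

(** Up to the factor e^(-s a) / s, the integrand is the exponential density shifted by a. *)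
Lemma integral_expR_itvcy (s a : R) : 0 < s ->
  (\int[mu]_(x in `[a, +oo[) (expR (- (s * x)))%:E = (expR (- (s * a)) / s)%:E)%E.
Proof.
move=> s0.
have [mpdf pdf0] := (measurable_exponential_pdf s, exponential_pdf_ge0 (ltW s0)).
have := @integral_exponential_pdf R s s0.
rewrite -(@ge0_integral_shift _ (EFin \o exponential_pdf s) (- a)); last 2 first.
- exact/measurable_EFinP.
- by move=> x; rewrite lee_fin.
move=> /(congr1 (fun z => (expR (- (s * a)) / s)%:E * z)%E) /=; rewrite mule1 => <-.
rewrite -ge0_integralZl//; last 3 first.
- apply/measurable_EFinP; apply: measurableT_comp => //; exact: measurable_funD.
- by move=> x _; rewrite lee_fin.
- by rewrite lee_fin divr_ge0 ?expR_ge0// ltW.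
rewrite [LHS]integral_mkcond; apply: eq_integral => x _ /=.
rewrite patchE mem_setE in_itv/= andbT.
have [ax|xa] := leP a x; last by rewrite lt0_exponential_pdf ?mule0// subr_lt0.
rewrite exponential_pdfE ?subr_ge0// -EFinM; congr EFin.
rewrite mulrA divfK ?gt_eqF// -expRD; congr expR; ring.
Qed.

(** Tonelli on the region y <= x; the integral in x is the previous lemma. *)
Lemma integral_laplace_primitive (h : R -> R) (s : R) : 0 < s ->
  measurable_fun setT h -> (forall x, 0 <= h x) -> (forall x : R, x <= 0 -> h x = 0) ->
  (\int[mu]_(x in `[0%R, +oo[) ((expR (- (s * x)))%:E * \int[mu]_(y in `[0%R, x]) (h y)%:E) =
   s^-1%:E * \int[mu]_x (expR (- (s * x)) * h x)%:E)%E.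
Proof.
move=> s0 mh h0 hneg.
pose f (z : R * R) : \bar R := ((z.2 <= z.1)%R%:R * (expR (- (s * z.1)) * h z.2))%:E.
have mf : measurable_fun setT f.
  apply/measurable_EFinP; apply: measurable_funM.
    apply: measurableT_comp => //.
    by apply: measurable_fun_ler; [exact: measurable_snd|exact: measurable_fst].
  apply: measurable_funM; last by apply: measurableT_comp => //; exact: measurable_snd.
  apply: (measurableT_comp (measurable_expRN s)); exact: measurable_fst.
have f0 z : (0 <= f z)%E by rewrite lee_fin !mulr_ge0// expR_ge0.
transitivity (\int[mu]_x \int[mu]_y f (x, y))%E.
  rewrite [LHS]integral_mkcond; apply: eq_integral => x _.
  rewrite patchE mem_setE in_itv/= andbT; have [x0|x0] := leP 0 x; last first.
    rewrite integral0_eq// => y _; rewrite /f /=.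
    have [yx|] := leP y x; last by rewrite mul0r.
    by rewrite hneg ?mulr0//; lra.
  rewrite -ge0_integralZl//; last 2 first.
  - exact/measurable_EFinP/measurable_funTS.
  - by move=> y _; rewrite lee_fin.
  rewrite [LHS]integral_mkcond; apply: eq_integral => y _.
  rewrite patchE mem_setE in_itv/= /f /= andbC.
  have [yx|] := leP y x; last by rewrite mul0r.
  have [y0|y0] /= := leP 0 y; first by rewrite mul1r.
  by rewrite hneg ?mulr0// ltW.
rewrite (@fubini_tonelli _ _ _ _ _ mu mu f)// -ge0_integralZl//; last 3 first.
- by apply/measurable_EFinP; apply: measurable_funM => //; exact: measurable_expRN.
- by move=> y _; rewrite lee_fin mulr_ge0// expR_ge0.
- by rewrite lee_fin invr_ge0 ltW.
apply: eq_integral => y _.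
transitivity ((h y)%:E * \int[mu]_(x in `[y, +oo[) (expR (- (s * x)))%:E)%E; last first.
  by rewrite integral_expR_itvcy// -!EFinM; congr EFin; ring.
rewrite -ge0_integralZl//; last 2 first.
- by apply/measurable_EFinP/measurable_funTS; exact: measurable_expRN.
- by rewrite lee_fin.
rewrite [RHS]integral_mkcond; apply: eq_integral => x _.
rewrite patchE mem_setE in_itv/= /f /= andbT.
by have [yx|] := leP y x; rewrite ?mul0r// mul1r mulrC EFinM.
Qed.

End ExponentialIntegrals.

(** * Smoothness of the scale function *)

Section RealFunctions.
Context {R : realType}.
Local Notation mu := (@lebesgue_measure R).

Lemma integrable_dominated (f g : R -> R) (D : set R) : measurable D ->
  measurable_fun D f -> measurable_fun D g -> (forall x, D x -> 0 <= f x <= g x) ->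
  (\int[mu]_(x in D) (g x)%:E < +oo)%E -> mu.-integrable D (EFin \o f).
Proof.
move=> mD mf mg fg goo; apply/integrableP; split; first exact/measurable_EFinP.
apply: le_lt_trans goo; apply: ge0_le_integral => //.
- by apply: measurableT_comp => //; exact/measurable_EFinP.
- exact/measurable_EFinP.
- by move=> x /fg /andP[f0 ?]; rewrite /= ger0_norm// lee_fin.
Qed.

Lemma near_eq_continuous (f g : R -> R) (x : R) :
  (\forall y \near x, g y = f y) -> {for x, continuous g} -> {for x, continuous f}.
Proof.
move=> gf cg; have /= gfx := nbhs_singleton gf.
apply: cvg_trans (near_eq_cvg gf) _.
by have := cg; rewrite /prop_for /continuous_at gfx.
Qed.

(** Both directions of the criterion need such a combination: one solves for the primitive of [K] in
    terms of [W], the other for [W]. *)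
Lemma derive1_affine (f g : R -> R) (a b c x : R) :
  derivable f x 1 -> derivable g x 1 ->
  derivable (fun z => a * f z + b + c * g z) x 1 /\
  (fun z => a * f z + b + c * g z)^`()%classic x =
    a * f^`()%classic x + c * g^`()%classic x.
Proof.
move=> df dg.
have daf := derivableZ (k:=a) df; have dcg := derivableZ (k:=c) dg.
have dab := derivableD daf (derivable_cst (V:=R) (W:=R) b x 1).
have d := derivableD dab dcg.
have -> : (fun z => a * f z + b + c * g z) = (a \*: f + cst b + c \*: g) by [].
split; first exact: d.
rewrite !derive1E (deriveD dab dcg) (deriveD daf (derivable_cst (V:=R) (W:=R) b x 1)).
by rewrite derive_cst addr0 (deriveZ a df) (deriveZ c dg).
Qed.

(** H(y) - m y has a maximum at the interior point x. This identifies the derivative of the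
    primitive of [K] without continuity of [K]. *)
Lemma derive1_supergradient (H : R -> R) (x m : R) : 0 < x ->
  (forall y, 0 < y -> derivable H y 1) ->
  (forall y, 0 < y -> H y <= H x + m * (y - x)) -> H^`()%classic x = m.
Proof.
move=> x0 dH sup.
pose l (y : R) := m * y.
have dl y : derivable l y 1 by apply: derivableM => //; exact: derivable_id.
have dHl y : 0 < y -> derivable (H - l) y 1 by move=> ?; apply: derivableB => //; exact: dH.
have : is_derive x 1 (H - l) 0.
  apply: (@derive1_at_max _ _ 0 (x + 1)).
  - by lra.
  - by move=> y; rewrite in_itv/= => /andP[y0 _]; exact: dHl.
  - by rewrite in_itv/= x0/= ltrDl.
  - move=> y; rewrite in_itv/= => /andP[y0 _]; have := sup y y0.
    by rewrite /l !fctE/=; lra.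
move=> /(@derive_val _ _ _ _ _ _ _); rewrite deriveB//; last exact: dH.
rewrite -!derive1E => /eqP; rewrite subr_eq0 => /eqP ->.
by rewrite /l derive1Ml// derive1_id mulr1.
Qed.

End RealFunctions.

(** * The criterion for a nonincreasing function known with its Laplace transform *)

Section ScaleSmoothness.
Context {R : realType}.
Local Notation mu := (@lebesgue_measure R).
Variables (T W tau : R -> R) (q delta s1 : R).
Hypotheses (q_ge0 : 0 <= q) (delta_gt0 : 0 < delta) (s1_ge0 : 0 <= s1).
Hypotheses (mT : measurable_fun setT T) (T_ge0 : forall x, 0 <= T x).
Hypothesis T_noninc : forall x y : R, 0 < x -> x <= y -> T y <= T x.
Hypothesis laplace_T : forall s, s1 < s ->
  (\int[mu]_(x in `]0%R, +oo[) (expR (- (s * x)) * T x)%:E = (tau s)%:E)%E.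
Hypothesis psi_gt0 : forall s, s1 < s -> 0 < delta * s - s * tau s - q.
Hypotheses (W_neg : forall x : R, x < 0 -> W x = 0) (W_ge0 : forall x, 0 <= W x).
Hypothesis W_cont : {within `[0, +oo[, continuous W}.
Hypothesis W_nd : {in `[0, +oo[ &, {homo W : x y / x <= y}}.
Hypothesis laplace_W : forall s, s1 < s ->
  (\int[mu]_(x in `[0%R, +oo[) (expR (- (s * x)) * W x)%:E =
   ((delta * s - s * tau s - q)^-1)%:E)%E.

(** Any tilt above [s1] would do: the mass of [k] is [kap theta], and psi(s) - q = delta s (1 - kap
    s), so that positivity of psi - q says exactly that kap < 1. *)
Let theta := s1 + 1.
Let K (x : R) := if 0 < x then (T x + q) / delta else 0.
Let k (x : R) := expR (- (theta * x)) * K x.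
Let kap (s : R) := (tau s + q / s) / delta.

Let theta_gt : s1 < theta. Proof. by rewrite ltrDl. Qed.

Let K_ge0 x : 0 <= K x.
Proof. by rewrite /K; case: ifP => // _; rewrite divr_ge0 ?addr_ge0// ltW. Qed.

Let mK : measurable_fun setT K.
Proof.
apply: measurable_fun_ifT => //.
- exact: measurable_fun_ltr.
- by apply: measurable_funM => //; apply: measurable_funD.
Qed.

Let mk : measurable_fun setT k.
Proof. by apply: measurable_funM => //; exact: measurable_expRN. Qed.

Let laplace_K s : s1 < s ->
  (\int[mu]_x (expR (- (s * x)) * K x)%:E = (kap s)%:E)%E.
Proof.
move=> s1s; have s0 : 0 < s by exact: le_lt_trans s1s.
transitivity (\int[mu]_(x in `]0%R, +oo[)
    (delta^-1%:E * ((expR (- (s * x)) * T x)%:E + q%:E * (expR (- (s * x)))%:E)))%E.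
  rewrite [RHS]integral_mkcond; apply: eq_integral => x _.
  rewrite patchE mem_setE in_itv/= andbT /K; case: ifP => _; last by rewrite mulr0.
  rewrite -[RHS]/((delta^-1 * (expR (- (s * x)) * T x + q * expR (- (s * x))))%:E).
  by congr EFin; ring.
have me : measurable_fun (`]0%R, +oo[%classic : set R) (fun x : R => (expR (- (s * x)))%:E).
  by apply/measurable_EFinP/measurable_funTS; exact: measurable_expRN.
have meT : measurable_fun (`]0%R, +oo[%classic : set R) (fun x : R => (expR (- (s * x)) * T x)%:E).
  apply/measurable_EFinP/measurable_funTS; apply: measurable_funM => //.
  exact: measurable_expRN.
have eT0 x : (0 <= (expR (- (s * x)) * T x)%:E)%E.
  by rewrite lee_fin mulr_ge0// expR_ge0.
have qe0 x : (0 <= q%:E * (expR (- (s * x)))%:E)%E.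
  by rewrite mule_ge0// lee_fin// expR_ge0.
rewrite ge0_integralZl//; last 3 first.
- by apply: emeasurable_funD => //; exact: measurable_funeM.
- by move=> x _; rewrite adde_ge0.
- by rewrite lee_fin invr_ge0 ltW.
rewrite ge0_integralD//; last exact: measurable_funeM.
rewrite laplace_T// ge0_integralZl//.
rewrite integral_itv_obnd_cbnd//.
rewrite integral_expR_itvcy// mulr0 oppr0 expR0.
rewrite -[LHS]/((delta^-1 * (tau s + q * (1 / s)))%:E).
by congr EFin; rewrite /kap; ring.
Qed.

Let kap_lt1 s : s1 < s -> kap s < 1.
Proof.
move=> s1s; have s0 : 0 < s by exact: le_lt_trans s1s.
have := psi_gt0 s1s; rewrite /kap ltr_pdivrMr// mul1r => h.
rewrite -(ltr_pM2l s0) mulrDr [s * (q / s)]mulrC divfK ?gt_eqF//.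
by move: h; rewrite [s * delta]mulrC; lra.
Qed.

Let kap_inv s : s1 < s ->
  (delta * s - s * tau s - q)^-1 = delta^-1 * (s^-1 * (1 + kap s / (1 - kap s))).
Proof.
move=> s1s; have s0 : 0 < s by exact: le_lt_trans s1s.
have h1 : 1 - kap s != 0 by rewrite gt_eqF// subr_gt0 kap_lt1.
have -> : delta * s - s * tau s - q = delta * s * (1 - kap s).
  by rewrite /kap; field; rewrite !gt_eqF.
by field; rewrite h1 !gt_eqF.
Qed.

Let k_noninc (x y : R) : 0 < x -> x <= y -> k y <= k x.
Proof.
move=> x0 xy; have y0 := lt_le_trans x0 xy.
apply: ler_pM => //.
- rewrite ler_expR lerN2 ler_wpM2l//.
  by rewrite ltW// (le_lt_trans s1_ge0).
- by rewrite /K x0 y0 ler_wpM2r ?invr_ge0 ?(ltW delta_gt0)// lerD2r T_noninc.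
Qed.

Let W_nondecreasing : nondecreasing_fun W.
Proof.
move=> x y xy; have [x0|x0] := ltP x 0; first by rewrite W_neg.
by apply: W_nd => //; rewrite in_itv/= andbT//; exact: le_trans x0 xy.
Qed.

Let W_cont_pos (x : R) : 0 < x -> {for x, continuous W}.
Proof.
move=> x0; have /continuous_within_itvcyP[+ _] := W_cont.
by apply; rewrite in_itv/= andbT.
Qed.

Let integrable_weighted (w : R -> R) (u : R) : measurable_fun setT w ->
  (forall x, 0 <= w x) -> (\int[mu]_x (w x)%:E < +oo)%E ->
  mu.-integrable `[0%R, u] (EFin \o (fun y => expR (theta * y) * w y)).
Proof.
move=> mw w0 woo.
have mE : measurable_fun setT (fun y : R => expR (theta * y)).
  by apply: measurableT_comp => //; exact: measurable_funM.
apply: (@integrable_dominated _ _ (fun y => expR (theta * u) * w y)) => //.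
- by apply: measurable_funTS; exact: measurable_funM.
- by apply: measurable_funTS; exact: measurable_funM.
- move=> y /=; rewrite in_itv/= => /andP[y0 yu].
  rewrite mulr_ge0 ?expR_ge0//= ler_wpM2r// ler_expR ler_wpM2l//.
  by rewrite ltW// (le_lt_trans s1_ge0).
under eq_integral do rewrite EFinM.
rewrite ge0_integralZl//; last 2 first.
- by apply/measurable_EFinP/measurable_funTS.
- by move=> y _; rewrite lee_fin.
rewrite lte_mul_pinfty ?lee_fin ?expR_ge0//.
apply: le_lt_trans woo; apply: ge0_subset_integral => //.
  exact/measurable_EFinP.
by move=> y _; rewrite lee_fin.
Qed.

Let primitive (f : R -> R) (x : R) := \int[mu]_(y in `[0, x]) f y.

(* The point is that [b], unlike [K], is continuous. *)
Let W_split : exists b : R -> R,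
  [/\ forall x : R, 0 < x -> {for x, continuous b},
      forall u, mu.-integrable `[0%R, u] (EFin \o b),
      forall u, mu.-integrable `[0%R, u] (EFin \o K) &
      forall x : R, 0 < x -> W x = (1 + primitive K x + primitive b x) / delta].
Proof.
have k_ge0 x : 0 <= k x by rewrite mulr_ge0// expR_ge0.
have k_neg (x : R) : x <= 0 -> k x = 0 by move=> x0; rewrite /k /K ltNge x0/= mulr0.
have int_k : (\int[mu]_x (k x)%:E = (kap theta)%:E)%E by exact: laplace_K.
have [w [c [mw w_ge0' laplace_w cc wE]]] :=
  renewal_density_split mk k_ge0 k_neg k_noninc int_k (kap_lt1 theta_gt).
have w_ge0 x : 0 <= w x by have [] := w_ge0' x.
have w_neg (x : R) : x <= 0 -> w x = 0 by have [] := w_ge0' x.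
have intk_lty : (\int[mu]_x (k x)%:E < +oo)%E by rewrite int_k ltry.
have intw_lty : (\int[mu]_x (w x)%:E < +oo)%E.
  have e0 (x y : R) : expR (- (0 * x)) * y = y by rewrite mul0r oppr0 expR0 mul1r.
  have : (\int[mu]_x (expR (- (0 * x)) * k x)%:E = (kap theta)%:E)%E.
    by under eq_integral do rewrite e0.
  move=> /(laplace_w 0 (kap theta) (lexx 0)).
  by under eq_integral do rewrite e0; move=> ->; rewrite ltry.
(* Undoing the tilt: [h] is the sum of the convolution powers of [K], and [b] is what remains after
   removing [K]. *)
pose h (x : R) := expR (theta * x) * w x.
pose b (x : R) := expR (theta * x) * (w x - k x).
have eK x : expR (theta * x) * k x = K x by rewrite /k mulrA -expRD subrr expR0 mul1r.
have hE : h = K \+ b by apply/funext => x; rewrite /h /b /= mulrBr eK; ring.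
have ih u : mu.-integrable `[0%R, u] (EFin \o h) by exact: integrable_weighted.
have iK u : mu.-integrable `[0%R, u] (EFin \o K).
  have := @integrable_weighted k u mk k_ge0 intk_lty.
  by apply: eq_integrable => // x _ /=; rewrite eK.
have bE : b = h \- K by apply/funext => x; rewrite hE /=; ring.
have ib u : mu.-integrable `[0%R, u] (EFin \o b).
  have : mu.-integrable `[0%R, u] ((EFin \o h) \- (EFin \o K))%E.
    exact: integrableB.
  by apply: eq_integrable => // x _ /=; rewrite bE.
exists b; split => //.
  move=> x x0.
  have : {for x, continuous (fun y => expR (theta * y) * (c y / y))}.
    apply: continuousM.
      apply: continuous_comp; last exact: continuous_expR.
      exact: mulrl_continuous.
    apply: continuousM; first exact: cc.
    by apply: inv_continuous; rewrite gt_eqF.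
  apply: near_eq_continuous; near=> y.
  have y0 : 0 < y by near: y; exact: lt_nbhsr.
  by rewrite /b wE//; congr (_ * _); ring.
have mh : measurable_fun setT h.
  by apply: measurable_funM => //; apply: measurableT_comp => //; exact: measurable_funM.
have h_ge0 x : 0 <= h x by rewrite mulr_ge0// expR_ge0.
have h_neg (x : R) : x <= 0 -> h x = 0 by move=> x0; rewrite /h w_neg// mulr0.
(* The candidate for [W]; its transform is computed next, and uniqueness identifies the two. *)
pose g x := (1 + primitive h x) / delta.
have prim_ge0 x : 0 <= primitive h x by apply: Rintegral_ge0.
have g_ge0 x : 0 <= g x by rewrite divr_ge0 ?addr_ge0// ltW.
have mg : measurable_fun setT g.
  apply: nondecreasing_measurable => // x y xy.
  rewrite ler_wpM2r ?invr_ge0 ?(ltW delta_gt0)// lerD2l.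
  apply: fine_le.
  - exact: integrable_fin_num.
  - exact: integrable_fin_num.
  apply: ge0_subset_integral => //.
  - exact/measurable_EFinP/measurable_funTS.
  - by move=> z _; rewrite lee_fin.
  - by apply: subset_itvl; rewrite bnd_simp.
have gc (x : R) : 0 < x -> {for x, continuous g}.
  move=> x0; apply: continuousM; last exact: cst_continuous.
  apply: continuousD; first exact: cst_continuous.
  have x01 : (0 : R) < x + 1 by rewrite addr_gt0.
  have := parameterized_integral_continuous (ltW x01) (ih (x + 1)).
  move=> /(continuous_within_itvP _ x01)[+ _ _]; apply.
  by rewrite in_itv/= x0/= ltrDl.
(* Only s above [theta], because the transform of [w] is known at the nonnegative weight s -
   theta. *)
have lg s : theta < s -> (\int[mu]_(x in `[0%R, +oo[) (expR (- (s * x)) * g x)%:E =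
    ((delta * s - s * tau s - q)^-1)%:E)%E.
  move=> ts; have s1s := lt_trans theta_gt ts.
  have s0 : 0 < s by exact: le_lt_trans s1s.
  transitivity (\int[mu]_(x in `[0%R, +oo[) (delta^-1%:E * ((expR (- (s * x)))%:E +
     (expR (- (s * x)))%:E * \int[mu]_(y in `[0%R, x]) (h y)%:E)))%E.
    apply: eq_integral => x _.
    have /integrable_fin_num hfin := ih x.
    rewrite -[in RHS](fineK (hfin _))//.
    rewrite -[RHS]/((delta^-1 * (expR (- (s * x)) + expR (- (s * x)) * primitive h x))%:E).
    by congr EFin; rewrite /g; ring.
  have me : measurable_fun (`[0%R, +oo[%classic : set R) (fun x : R => (expR (- (s * x)))%:E).
    by apply/measurable_EFinP/measurable_funTS; exact: measurable_expRN.
  have meI : measurable_fun (`[0%R, +oo[%classic : set R) (fun x : R => ((expR (- (s * x)))%:E *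
      \int[mu]_(y in `[0%R, x]) (h y)%:E)%E).
    have -> : (fun x : R => ((expR (- (s * x)))%:E * \int[mu]_(y in `[0%R, x]) (h y)%:E)%E) =
        EFin \o (fun x : R => expR (- (s * x)) * (delta * g x - 1)).
      apply/funext => x; have /integrable_fin_num hfin := ih x.
      rewrite -[X in (_ * X)%E](fineK (hfin _))//= -EFinM; congr EFin.
      congr (_ * _); by rewrite /g [delta * _]mulrC divfK ?gt_eqF// [1 + _]addrC addrK.
    apply/measurable_EFinP/measurable_funTS; apply: measurable_funM.
      exact: measurable_expRN.
    by apply: measurable_funB => //; exact: measurable_funM.
  have eI0 x : (0 <= (expR (- (s * x)))%:E * \int[mu]_(y in `[0%R, x]) (h y)%:E)%E.
    by rewrite mule_ge0 ?lee_fin ?expR_ge0//; apply: integral_ge0 => y _; rewrite lee_fin.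
  rewrite ge0_integralZl//; last 3 first.
  - exact: emeasurable_funD.
  - by move=> x _; rewrite adde_ge0// lee_fin expR_ge0.
  - by rewrite lee_fin invr_ge0 ltW.
  rewrite ge0_integralD// integral_laplace_primitive//.
  rewrite integral_expR_itvcy// mulr0 oppr0 expR0.
  have sth : 0 <= s - theta by rewrite subr_ge0 ltW.
  have lk : (\int[mu]_x (expR (- ((s - theta) * x)) * k x)%:E = (kap s)%:E)%E.
    rewrite -laplace_K//; apply: eq_integral => x _; congr EFin.
    by rewrite /k mulrA -expRD; congr (expR _ * _); ring.
  have -> : (\int[mu]_x (expR (- (s * x)) * h x)%:E = (kap s / (1 - kap s))%:E)%E.
    rewrite -(laplace_w _ _ sth lk); apply: eq_integral => x _; congr EFin.
    by rewrite /h mulrA -expRD; congr (expR _ * _); ring.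
  rewrite -[LHS]/((delta^-1 * (1 / s + s^-1 * (kap s / (1 - kap s))))%:E).
  by congr EFin; rewrite kap_inv//; ring.
move=> x x0.
have -> : W x = g x.
  apply: (@laplace_unique _ W g theta) => //.
  - exact: nondecreasing_measurable.
  - by move=> s ts; rewrite laplace_W ?ltry//; exact: lt_trans ts.
  - by move=> s ts; rewrite lg// laplace_W//; exact: lt_trans ts.
  - exact: W_cont_pos.
  - exact: gc.
rewrite /g; congr (_ / _); rewrite -addrA; congr (_ + _).
by rewrite /primitive hE RintegralD.
Unshelve. all: by end_near. Qed.

Let derivable_primitive (f : R -> R) (x : R) : 0 < x ->
  (forall u, mu.-integrable `[0%R, u] (EFin \o f)) -> {for x, continuous f} ->
  derivable (primitive f) x 1 /\ (primitive f)^`()%classic x = f x.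
Proof.
move=> x0 if_ cf; apply: (@continuous_FTC1_closed _ f 0 x (x + 1)) => //.
by rewrite ltrDl.
Qed.

(** The primitive of a nonincreasing function is concave, and [K x] is a supergradient at x even if
    [K] jumps there. *)
Let primitive_K_le (x y : R) : (forall u, mu.-integrable `[0%R, u] (EFin \o K)) ->
  0 < x -> 0 < y -> primitive K y <= primitive K x + K x * (y - x).
Proof.
move=> iK x0 y0.
have K_noninc (u v : R) : 0 < u -> u <= v -> K v <= K u.
  move=> u0 uv; rewrite /K u0 (lt_le_trans u0 uv).
  by rewrite ler_wpM2r ?invr_ge0 ?(ltW delta_gt0)// lerD2r T_noninc.
have itvB (u v : R) : 0 < u -> u <= v ->
    primitive K v - primitive K u = \int[mu]_(z in `]u, v]) K z.
  by move=> u0 uv; apply: Rintegral_itvB => //; rewrite bnd_simp// ltW.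
have iuv (u v : R) : 0 < u -> mu.-integrable `]u, v] (EFin \o K).
  move=> u0; apply: integrableS (iK v) => //.
  by apply: subset_itvr; rewrite bnd_simp ltW.
have int_cst (u v : R) : u <= v ->
    (\int[mu]_(z in `]u, v]) (K x)%:E = (K x * (v - u))%:E)%E.
  move=> uv; rewrite integral_cst//= lebesgue_measure_itv/= lte_fin.
  move: uv; rewrite le_eqVlt => /predU1P[->|->]; last by rewrite -EFinD -EFinM.
  by rewrite ltxx subrr mulr0 mule0.
have icst (u v : R) : u <= v -> mu.-integrable `]u, v] (EFin \o cst (K x)).
  move=> uv; apply: (@integrable_dominated _ _ (cst (K x))) => //.
  - by move=> z _ /=; rewrite lexx andbT.
  - by rewrite int_cst// ltry.
have Rint_cst (u v : R) : u <= v -> \int[mu]_(z in `]u, v]) K x = K x * (v - u).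
  by move=> uv; rewrite /Rintegral int_cst.
have [xy|yx] := leP x y.
  rewrite -lerBlDl itvB// -Rint_cst//; apply: le_Rintegral => //.
  - exact: iuv.
  - exact: icst.
  - by move=> z /=; rewrite in_itv/= => /andP[xz _]; apply: K_noninc => //; exact: ltW.
have : K x * (x - y) <= primitive K x - primitive K y.
  rewrite itvB ?(ltW yx)// -Rint_cst ?(ltW yx)//; apply: le_Rintegral => //.
  - by apply: icst; exact: ltW.
  - exact: iuv.
  - move=> z /=; rewrite in_itv/= => /andP[yz zx]; apply: K_noninc => //.
    exact: lt_trans yz.
lra.
Qed.

Lemma scale_smooth_iff : C1_pos W <-> C0_pos T.
Proof.
have [b [cb ib iK WE]] := W_split.
have near_pos (x : R) : 0 < x -> \forall y \near x, 0 < y by exact: lt_nbhsr.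
have dB (x : R) : 0 < x -> derivable (primitive b) x 1 /\ (primitive b)^`()%classic x = b x.
  by move=> x0; apply: derivable_primitive => //; exact: cb.
split.
- move=> [dW cW'] x x0.
  (* The primitive of [K] solved from [W_split]: it inherits differentiability from [W] and from the
     primitive of the continuous [b]. *)
  pose H y := delta * W y + (- 1) + (- 1) * primitive b y.
  have HE (y : R) : 0 < y -> primitive K y = H y.
    by move=> y0; rewrite /H WE// mulrC divfK ?gt_eqF//; ring.
  have dH (y : R) : 0 < y -> derivable H y 1 /\ H^`()%classic y = delta * W^`()%classic y - b y.
    move=> y0; have [dBy dBE] := dB y y0; have dWy := dW y y0.
    have [dHy ->] := derive1_affine delta (-1) (-1) dWy dBy.
    by rewrite dBE mulN1r.
  have KE (y : R) : 0 < y -> K y = delta * W^`()%classic y - b y.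
    move=> y0; have [_ <-] := dH y y0; apply: esym.
    apply: (derive1_supergradient y0) => z z0; first by have [] := dH z z0.
    by rewrite -!HE//; exact: primitive_K_le.
  have TE (y : R) : 0 < y -> T y = delta * (delta * W^`()%classic y - b y) - q.
    move=> y0; rewrite -KE// /K y0 mulrC divfK ?gt_eqF//; ring.
  have : {for x, continuous (fun y => delta * (delta * W^`()%classic y - b y) - q)}.
    apply: continuousB; last exact: cst_continuous.
    apply: continuousM; first exact: cst_continuous.
    apply: continuousB; last exact: cb.
    by apply: continuousM; [exact: cst_continuous|exact: cW'].
  apply: near_eq_continuous; near=> y.
  by rewrite TE//; near: y; exact: near_pos.
- move=> cT.
  have cK (x : R) : 0 < x -> {for x, continuous K}.
    move=> x0.
    have : {for x, continuous (fun y => (T y + q) / delta)}.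
      apply: continuousM; last exact: cst_continuous.
      by apply: continuousD; [exact: cT|exact: cst_continuous].
    apply: near_eq_continuous; near=> y.
    by rewrite /K ifT//; near: y; exact: near_pos.
  pose G y := delta^-1 * primitive K y + delta^-1 + delta^-1 * primitive b y.
  have dG (y : R) : 0 < y -> derivable G y 1 /\ G^`()%classic y = (K y + b y) / delta.
    move=> y0; have [dBy dBE] := dB y y0.
    have [dKy dKE] := derivable_primitive y0 iK (cK y y0).
    have [dGy ->] := derive1_affine delta^-1 delta^-1 delta^-1 dKy dBy.
    by rewrite dKE dBE; split=> //; ring.
  have WGE (x : R) : 0 < x -> W x = G x by move=> x0; rewrite WE// /G; ring.
  have WG (x : R) : 0 < x -> \forall y \near x, W y = G y.
    by move=> x0; near=> y; apply: WGE; near: y; exact: near_pos.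
  have GW (x : R) : 0 < x -> \forall y \near x, G y = W y.
    by move=> x0; near=> y; apply/esym/WGE; near: y; exact: near_pos.
  have W'E (x : R) : 0 < x -> W^`()%classic x = (K x + b x) / delta.
    by move=> x0; have [_ <-] := dG x x0; rewrite !derive1E; apply: near_eq_derive; exact: WG.
  split=> x x0.
    by apply: near_eq_derivable (GW x x0) _; have [] := dG x x0.
  have : {for x, continuous (fun y => (K y + b y) / delta)}.
    apply: continuousM; last exact: cst_continuous.
    by apply: continuousD; [exact: cK|exact: cb].
  apply: near_eq_continuous; near=> y.
  by rewrite W'E//; near: y; exact: near_pos.
Unshelve. all: by end_near. Qed.

End ScaleSmoothness.

(** * The Laplace exponent *)

Section TailIntegral.
Context {R : realType}.
Local Notation mu := (@lebesgue_measure R).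
Local Open Scope ereal_scope.
Variable nu : {sigma_finite_measure set R -> \bar R}.

Lemma measurable_tail_measure : measurable_fun setT (fun y : R => nu `]y, +oo[%classic).
Proof.
pose f (z : R * R) : \bar R := ((z.1 < z.2)%R%:R)%:E.
have mf : measurable_fun setT f.
  apply/measurable_EFinP; apply: measurableT_comp => //.
  by apply: measurable_fun_ltr; [exact: measurable_fst|exact: measurable_snd].
have f0 z : 0 <= f z by rewrite lee_fin.
have := measurable_fun_fubini_tonelli_F (m2 := nu) f mf f0.
apply: eq_measurable_fun => y _; rewrite /fubini_F.
rewrite -[RHS]mul1e -integral_cst// [RHS]integral_mkcond; apply: eq_integral => x _.
by rewrite patchE mem_setE in_itv/= andbT /f /=; case: ifP.
Qed.

(** Tonelli after writing 1 - e^(-s x) as the integral of s e^(-s y) over 0 < y < x. *)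
Lemma integral_1BexpR_tail (s : R) : (0 < s)%R ->
  \int[nu]_(x in `]0%R, +oo[) (1 - expR (- (s * x)))%:E =
  \int[mu]_(y in `]0%R, +oo[) ((s * expR (- (s * y)))%:E * nu `]y, +oo[%classic).
Proof.
move=> s0.
have mse : measurable_fun setT (fun y : R => s * expR (- (s * y)))%R.
  by apply: measurable_funM => //; exact: measurable_expRN.
have se0 (y : R) : (0 <= s * expR (- (s * y)))%R by rewrite mulr_ge0 ?expR_ge0// ltW.
pose f (z : R * R) : \bar R :=
  ((0 < z.2)%R%:R * ((z.2 < z.1)%R%:R * (s * expR (- (s * z.2)))))%:E.
have mf : measurable_fun setT f.
  apply/measurable_EFinP; apply: measurable_funM.
    apply: measurableT_comp => //.
    by apply: measurable_fun_ltr => //; exact: measurable_snd.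
  apply: measurable_funM.
    apply: measurableT_comp => //.
    by apply: measurable_fun_ltr; [exact: measurable_snd|exact: measurable_fst].
  by apply: (measurableT_comp mse); exact: measurable_snd.
have f0 z : 0 <= f z by rewrite lee_fin !mulr_ge0// ?expR_ge0// ltW.
have primE (x : R) : (0 < x)%R ->
    \int[mu]_(y in `]0%R, x[) (s * expR (- (s * y)))%:E = (1 - expR (- (s * x)))%:E.
  move=> x0.
  have full (a : R) : \int[mu]_(y in `[a, +oo[) (s * expR (- (s * y)))%:E =
      (expR (- (s * a)))%:E.
    under eq_integral do rewrite EFinM.
    rewrite ge0_integralZl//; last 2 first.
    - by apply/measurable_EFinP/measurable_funTS; exact: measurable_expRN.
    - by rewrite lee_fin ltW.
    by rewrite integral_expR_itvcy// -EFinM mulrC divfK// gt_eqF.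
  have := full 0%R; rewrite (@itv_bndbnd_setU _ _ _ (BLeft x)); last 2 first.
  - by rewrite bnd_simp ltW.
  - by [].
  rewrite ge0_integral_setU//=; last 3 first.
  - by apply/measurable_EFinP/measurable_funTS; exact: mse.
  - by move=> y _; rewrite lee_fin.
  - apply/disj_setPS => y [/=]; rewrite 2!in_itv/= => /andP[_ yx] /andP[].
    by rewrite leNgt yx.
  rewrite full mulr0 oppr0 expR0 -integral_itv_obnd_cbnd; last first.
    by apply/measurable_EFinP/measurable_funTS; exact: mse.
  move=> /(congr1 (fun z => z - (expR (- (s * x)))%:E)); rewrite addeK// => ->.
transitivity (\int[nu]_x \int[mu]_y f (x, y)).
  rewrite [LHS]integral_mkcond; apply: eq_integral => x _.
  rewrite patchE mem_setE in_itv/= andbT; case: ifPn => x0.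
    rewrite -primE// [LHS]integral_mkcond; apply: eq_integral => y _.
    rewrite patchE mem_setE in_itv/= /f /=.
    by case: (0 < y)%R; case: (y < x)%R; rewrite /= ?mul1r ?mul0r.
  rewrite integral0_eq// => y _; rewrite /f /=; case: (ltP 0%R y) => y0; last by rewrite mul0r.
  by rewrite ltNge (_ : (x <= y)%R) ?mul0r ?mulr0// (le_trans _ (ltW y0))// leNgt.
rewrite (@fubini_tonelli _ _ _ _ _ nu mu f)// [RHS]integral_mkcond.
apply: eq_integral => y _; rewrite patchE mem_setE in_itv/= andbT.
case: ifPn => y0; last by apply: integral0_eq => x _; rewrite /f /= (negbTE y0) mul0r.
rewrite -[nu _]mul1e -integral_cst// -ge0_integralZl//; last first.
  by rewrite lee_fin.
rewrite [RHS]integral_mkcond; apply: eq_integral => x _.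
by rewrite patchE mem_setE in_itv/= andbT /f /= y0 mul1r; case: ifP => _;
  rewrite ?mul1r ?mule1 ?mul0r.
Qed.

End TailIntegral.

(** * Growth of the Laplace exponent at infinity *)

Section LevyMeasure.
Context {R : realType}.
Local Notation mu := (@lebesgue_measure R).
Variables (gamma sigma : R) (Pi : {measure set R -> \bar R}).
Hypothesis levyPi : levy_measure Pi.
Local Notation psi := (levy_khintchine gamma sigma Pi).

Let I : set R := `]0, +oo[%classic.
Let m (x : R) := Num.min 1 (x ^+ 2).
Let G (theta x : R) := 1 - expR (- (theta * x)) - theta * x * \1_(`]0, 1[ : set R) x.

Let mI : measurable I. Proof. exact: measurable_itv. Qed.

Let posI (x : R) : I x -> 0 < x.
Proof. by rewrite /I /= in_itv/= andbT. Qed.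

Let m_ge0 x : 0 <= m x. Proof. by rewrite /m le_min ler01 sqr_ge0. Qed.

Let mm : measurable_fun setT m.
Proof. by apply: measurable_minr => //; exact: measurable_funX. Qed.

Let mG theta : measurable_fun setT (G theta).
Proof.
apply: measurable_funB.
  by apply: measurable_funB => //; exact: measurable_expRN.
by apply: measurable_funM; [exact: measurable_funM|exact: measurable_indic].
Qed.

Let int_m_lty : (\int[Pi]_(x in I) (m x)%:E < +oo)%E.
Proof. by have [_] := levyPi. Qed.

Let integrable_m : Pi.-integrable I (EFin \o m).
Proof.
apply/integrableP; split; first exact/measurable_EFinP/measurable_funTS.
by under eq_integral do rewrite /= ger0_norm//.
Qed.

Let int_m_ge0 : 0 <= \int[Pi]_(x in I) m x.
Proof. exact: Rintegral_ge0. Qed.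

(** Markov's inequality for [m], which is nondecreasing on the positive half-line. *)
Lemma levy_tail_lty (x : R) : 0 < x -> (Pi `]x, +oo[%classic < +oo)%E.
Proof.
move=> x0; have mx0 : 0 < m x by rewrite /m lt_min ltr01 exprn_gt0.
rewrite -(@lte_pmul2l _ (m x)%:E) ?lte_fin// gt0_muley ?lte_fin//.
apply: le_lt_trans int_m_lty; rewrite -integral_cst//.
apply: (@le_trans _ _ (\int[Pi]_(y in `]x, +oo[) (m y)%:E)%E).
  apply: ge0_le_integral => //.
  - by move=> y _; rewrite lee_fin.
  - by apply/measurable_EFinP/measurable_funTS.
  - move=> y /=; rewrite in_itv/= andbT => xy; rewrite lee_fin /m.
    by rewrite le_min ge_min lexx/= ge_min lerXn2r ?orbT// ?nnegrE ltW//; lra.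
apply: ge0_subset_integral => //.
- exact/measurable_EFinP/measurable_funTS.
- by move=> y _; rewrite lee_fin.
- by move=> y; rewrite /I /= !in_itv/= !andbT; exact: lt_trans.
Qed.

Let G_small theta x : 0 <= theta -> 0 < x < 1 ->
  G theta x <= 0 /\ - (theta ^+ 2 * x ^+ 2) <= G theta x.
Proof.
move=> t0 /andP[x0 x1].
rewrite /G indicE mem_set; last by rewrite /= in_itv/= x0.
rewrite mulr1; set u := theta * x.
have u0 : 0 <= u by rewrite mulr_ge0// ltW.
have h1 := expR_ge1Dx (- u).
(* (1 - u + u^2)(1 + u) = 1 + u^3 >= 1, and e^u >= 1 + u. *)
have h2 : expR (- u) <= 1 - u + u ^+ 2.
  rewrite expRN -ler_pV2 ?invrK; last 2 first.
  - by rewrite inE/= unitfE gt_eqF ?expR_gt0//=; nra.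
  - by rewrite inE/= unitfE invr_eq0 gt_eqF ?invr_gt0 ?expR_gt0.
  apply: le_trans (expR_ge1Dx u).
  have d0 : 0 < 1 - u + u ^+ 2 by nra.
  rewrite -[leLHS]mul1r ler_pdivrMr//.
  have : 0 <= u ^+ 3 by rewrite exprn_ge0.
  by lra.
by rewrite -exprMn -/u; split; lra.
Qed.

Let G_large theta x : 0 <= theta -> 1 <= x -> 0 <= G theta x <= 1.
Proof.
move=> t0 x1.
rewrite /G indicE memNset; last by rewrite /= in_itv/= => /andP[_]; rewrite ltNge x1.
rewrite mulr0 subr0 lerBlDr lerDl expR_ge0 andbT subr_ge0.
by rewrite -expR0 ler_expR oppr_le0 mulr_ge0// (le_trans ler01).
Qed.

Let m_small (x : R) : 0 < x < 1 -> m x = x ^+ 2.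
Proof.
by move=> /andP[x0 x1]; rewrite /m min_r// exprn_ile1 ?ltW.
Qed.

Let m_large (x : R) : 1 <= x -> m x = 1.
Proof. by move=> x1; rewrite /m min_l// exprn_ege1. Qed.

Let G_norm theta x : 0 <= theta -> 0 < x -> `|G theta x| <= (1 + theta ^+ 2) * m x.
Proof.
move=> t0 x0; have [x1|x1] := ltP x 1.
  have x01 : 0 < x < 1 by rewrite x0.
  have [h1 h2] := G_small t0 x01.
  rewrite m_small// ler0_norm//.
  have := sqr_ge0 x; nra.
have /andP[h1 h2] := G_large t0 x1.
by rewrite m_large// mulr1 ger0_norm// (le_trans h2)// lerDl sqr_ge0.
Qed.

Let integrable_G theta : 0 <= theta -> Pi.-integrable I (EFin \o G theta).
Proof.
move=> t0.
have : Pi.-integrable I (fun x => ((1 + theta ^+ 2)%:E * (m x)%:E)%E) by exact: integrableZl.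
apply: le_integrable => //.
  exact/measurable_EFinP/measurable_funTS.
move=> x /posI x0; rewrite -EFinM /= lee_fin [leRHS]ger0_norm ?mulr_ge0 ?addr_ge0 ?sqr_ge0//.
exact: G_norm.
Qed.

(** By [G_norm] the integrand is at most (1 + l^2) [m]. The quadratic rate is what keeps E(e^(m
    X_h)) bounded for h = 1/m^2. *)
Lemma levy_khintchine_le_sq : exists A, forall l, 1 <= l -> psi l <= A * l ^+ 2.
Proof.
set M := \int[Pi]_(x in I) m x.
exists (`|gamma| + 2^-1 * sigma ^+ 2 + 2 * M) => l l1.
have l0 : 0 <= l by lra.
have intG : - (\int[Pi]_(x in I) G l x) <= (1 + l ^+ 2) * M.
  have -> : (1 + l ^+ 2) * M = \int[Pi]_(x in I) ((1 + l ^+ 2) * m x).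
    by rewrite RintegralZl.
  apply: (@le_trans _ _ `|\int[Pi]_(x in I) G l x|).
    by rewrite -[leRHS]normrN; exact: ler_norm.
  apply: le_trans (le_normr_Rintegral mI (integrable_G l0)) _.
  apply: le_Rintegral => //.
  - exact: (integrable_abse (integrable_G l0)).
  - exact: (@integrableZl _ _ _ Pi I mI (1 + l ^+ 2) _ integrable_m).
  - by move=> x /posI x0; exact: G_norm.
rewrite /levy_khintchine -/I.
have h1 : gamma * l <= `|gamma| * l ^+ 2.
  apply: (@le_trans _ _ (`|gamma| * l)); first by rewrite ler_wpM2r ?ler_norm.
  by rewrite ler_wpM2l// expr2 ler_peMr.
have h2 : (1 + l ^+ 2) * M <= 2 * M * l ^+ 2.
  have : 0 <= M * (l ^+ 2 - 1) by rewrite mulr_ge0 ?int_m_ge0// subr_ge0 exprn_ege1.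
  by lra.
move: intG; rewrite /G => intG; lra.
Qed.

(* [theta x - 1 + e^(- theta x) >= theta x / 2] as soon as [theta x >= 2]. *)
Let G_lower theta x : 1 <= theta -> 0 < x ->
  2^-1 * theta * x * \1_(`[2 / theta, 1[ : set R) x <= m x - G theta x.
Proof.
move=> t1 x0; have t0 : 0 < theta by lra.
have [x1|x1] := ltP x 1; last first.
  have /andP[h1 h2] := G_large (ltW t0) x1.
  rewrite m_large// indicE memNset ?mulr0 ?subr_ge0//.
  by rewrite /= in_itv/= => /andP[_]; rewrite ltNge x1.
have x01 : 0 < x < 1 by rewrite x0.
have [h1 _] := G_small (ltW t0) x01.
have [tx|tx] := leP (2 / theta) x; last first.
  rewrite indicE memNset ?mulr0 ?subr_ge0 ?(le_trans h1)//.
  by rewrite /= in_itv/= => /andP[]; rewrite leNgt tx.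
rewrite indicE mem_set ?mulr1; last by rewrite /= in_itv/= tx.
have : 2 <= theta * x by rewrite mulrC -ler_pdivrMr.
rewrite /G indicE mem_set ?mulr1; last by rewrite /= in_itv/= x0.
have := m_ge0 x; have := expR_ge0 (- (theta * x)).
set e := expR _; lra.
Qed.

(** Adding [m] makes m - G nonnegative everywhere, so the jump part of psi is at least -M and cannot
    compensate a Gaussian term: sigma = 0. Then [G_lower] bounds (l / 2) int x over [2/l, 1[ by M +
    C' l. After division by l / 2 the bound 2 (M + C') is uniform in l >= 1, and monotone
    convergence ends the proof. *)
Lemma linear_levy_khintchine (C : R) : 0 <= sigma ->
  (forall l, 1 <= l -> psi l <= C * l) ->
  sigma = 0 /\ (\int[Pi]_(x in `]0%R, 1%R[) x%:E < +oo)%E.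
Proof.
move=> sig0 psiC; set M := \int[Pi]_(x in I) m x.
pose C' := C + `|gamma|.
have GC l : 1 <= l -> 2^-1 * sigma ^+ 2 * l ^+ 2 - \int[Pi]_(x in I) G l x <= C' * l.
  move=> l1; have := psiC l l1; rewrite /levy_khintchine -/I -/(G l) /C'.
  have := ler_norm (- gamma); rewrite normrN => hg; have : - gamma * l <= `|gamma| * l by nra.
  by rewrite /G; lra.
have mGE l : 1 <= l -> \int[Pi]_(x in I) (m x - G l x) = M - \int[Pi]_(x in I) G l x.
  by move=> l1; rewrite RintegralB//; apply: integrable_G; lra.
have imG l : 1 <= l -> Pi.-integrable I (fun x => (m x - G l x)%:E).
  move=> l1; have := integrableB mI integrable_m (@integrable_G l _).
  by apply; lra.
have mG0 l x : 1 <= l -> I x -> 0 <= m x - G l x.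
  move=> l1 /posI x0; apply: le_trans (G_lower l1 x0).
  by rewrite mulr_ge0// mulr_ge0 ?(ltW x0)// mulr_ge0//; lra.
have M0 : 0 <= M by exact: int_m_ge0.
have MG l : 1 <= l -> - M <= - (\int[Pi]_(x in I) G l x).
  move=> l1; have : 0 <= \int[Pi]_(x in I) (m x - G l x).
    by apply: Rintegral_ge0 => x; exact: mG0.
  by rewrite mGE//; lra.
have s0 : sigma = 0.
  apply: contrapT => /eqP sn0.
  have s2 : 0 < 2^-1 * sigma ^+ 2 by rewrite mulr_gt0// exprn_even_gt0.
  set a := 2^-1 * sigma ^+ 2 in s2 GC.
  (* Chosen so that a l = a + |C'| + M, whereas the linear bound forces a l <= |C'| + M. *)
  pose l := 1 + (`|C'| + M) / a.
  have l1 : 1 <= l by rewrite lerDl divr_ge0 ?addr_ge0// ltW.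
  have al : a * l = a + `|C'| + M by rewrite /l mulrDr mulr1 mulrC divfK ?gt_eqF// addrA.
  have h1 := GC l l1; have h2 := MG l l1; have h3 := ler_norm C'.
  have : a * l ^+ 2 <= (`|C'| + M) * l by nra.
  rewrite expr2 mulrA al ler_pM2r; lra.
split => //.
have cv : (\int[Pi]_(x in `[(2 / n.+1%:R)%R, 1%R[) x%:E @[n --> \oo] -->
    \int[Pi]_(x in \bigcup_n `[(2 / n.+1%:R)%R, 1%R[%classic) x%:E)%E.
  apply: ge0_nondecreasing_set_cvg_integral => //.
  - apply/nondecreasing_seqP => n; apply/subsetPset => x /=; rewrite !in_itv/=.
    move=> /andP[nx ->]; rewrite andbT (le_trans _ nx)// ler_pM2l//.
    by rewrite lef_pV2 ?posrE// ler_nat.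
  - move=> n x /=; rewrite in_itv/= => /andP[nx _]; rewrite lee_fin.
    by apply: le_trans nx; rewrite divr_ge0.
have -> : `]0, 1[%classic = \bigcup_n `[2 / n.+1%:R, 1[%classic :> set R.
  apply/seteqP; split => x /=.
    rewrite in_itv/= => /andP[x0 x1]; exists (Num.truncn (2 / x)) => //=.
    rewrite in_itv/= x1 andbT ler_pdivrMr// mulrC -ler_pdivrMr//.
    by rewrite ltW// truncnS_gt.
  move=> [n _] /=; rewrite !in_itv/= => /andP[nx ->]; rewrite andbT.
  by apply: lt_le_trans nx; rewrite divr_gt0.
apply: (@le_lt_trans _ _ (2 * (M + C'))%:E); last exact: ltry.
apply: cvge_le cv; apply: nearW => n.
set l : R := n.+1%:R.
have l1 : 1 <= l by rewrite ler1n.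
have l0 : 0 < l by lra.
have : (\int[Pi]_(x in I) (2^-1 * l * x * \1_(`[2 / l, 1[ : set R) x)%:E <=
    (M + C' * l)%:E)%E.
  apply: (@le_trans _ _ (\int[Pi]_(x in I) (m x - G l x)%:E)%E).
    apply: ge0_le_integral => //.
    - by move=> x /posI x0; rewrite lee_fin !mulr_ge0// ltW.
    - apply/measurable_EFinP/measurable_funTS; apply: measurable_funM.
        exact: measurable_funM.
      exact: measurable_indic.
    - by apply/measurable_EFinP/measurable_funTS; exact: measurable_funB.
    - by move=> x /posI x0; rewrite lee_fin; exact: G_lower.
  rewrite -(fineK (integrable_fin_num mI (imG l l1))) lee_fin.
  rewrite -[X in X <= _]/(\int[Pi]_(x in I) (m x - G l x)) mGE//.
  have := GC l l1; have : 0 <= 2^-1 * sigma ^+ 2 * l ^+ 2 by rewrite !mulr_ge0 ?sqr_ge0.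
  lra.
have -> : (\int[Pi]_(x in I) (2^-1 * l * x * \1_(`[2 / l, 1[ : set R) x)%:E =
    (2^-1 * l)%R%:E * \int[Pi]_(x in `[(2 / l)%R, 1%R[) x%:E)%E.
  rewrite -ge0_integralZl//; last 2 first.
  - move=> x /=; rewrite in_itv/= => /andP[lx _]; rewrite lee_fin.
    by apply: le_trans lx; rewrite divr_ge0// ltW.
  - by rewrite lee_fin mulr_ge0// ltW.
  rewrite [LHS]integral_mkcond [RHS]integral_mkcond; apply: eq_integral => x _.
  rewrite !patchE indicE /I !mem_setE !in_itv/= andbT.
  have [x0|x0] := ltP 0 x; first by case: ifP; rewrite ?mulr1 ?mulr0 ?EFinM.
  rewrite ifF//; apply/negbTE; rewrite negb_and -ltNge.
  by rewrite (le_lt_trans x0)// divr_gt0.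
move=> h.
rewrite -(@lee_pmul2l _ (2^-1 * l)%:E)//; last by rewrite lte_fin mulr_gt0.
apply: le_trans h _; rewrite -EFinM lee_fin.
nra.
Qed.

End LevyMeasure.

(** * The Laplace exponent as drift and transform of the tail *)

Section LevyBoundedVariation.
Context {R : realType}.
Local Notation mu := (@lebesgue_measure R).
Variables (gamma : R) (Pi : {measure set R -> \bar R}).
Hypothesis levyPi : levy_measure Pi.
Hypothesis int_x_lty : (\int[Pi]_(x in `]0%R, 1%R[) x%:E < +oo)%E.
Let I : set R := `]0, +oo[%classic.

Let tail_lty := levy_tail_lty levyPi.

Let sigma_finite_Pi : sigma_finite setT Pi.
Proof.
(* The null half-line is adjoined to each set so that the cover is that of the whole line. *)
exists (fun n => `]-oo, 0]%classic `|` `]n.+1%:R^-1, +oo[%classic).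
  apply/esym/seteqP; split => // x _.
  have [x0|x0] := leP x 0; first by exists 0%N => //; left; rewrite /= in_itv.
  exists (Num.truncn x^-1) => //; right; rewrite /= in_itv/= andbT.
  by rewrite invf_plt ?posrE// truncnS_gt.
move=> n; split; first exact: measurableU.
apply: (@le_lt_trans _ _ (Pi `]-oo, 0%R]%classic + Pi `](n.+1%:R^-1)%R, +oo[%classic)%E).
  by rewrite measureU2.
have [-> _] := levyPi; rewrite add0e; exact: tail_lty.
Qed.

Lemma tailE (x : R) : 0 < x -> (tail Pi x)%:E = Pi `]x, +oo[%classic.
Proof.
by move=> x0; rewrite /tail fineK// ge0_fin_numE// tail_lty.
Qed.

Lemma tail_ge0 (x : R) : 0 <= tail Pi x.
Proof. exact: fine_ge0. Qed.

Lemma tail_noninc (x y : R) : 0 < x -> x <= y -> tail Pi y <= tail Pi x.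
Proof.
move=> x0 xy; rewrite -lee_fin !tailE//; last exact: lt_le_trans xy.
by apply: le_measure; rewrite ?inE//; apply: subset_itvr; rewrite bnd_simp.
Qed.

Lemma measurable_tail : measurable_fun setT (tail Pi).
Proof.
(* Sigma-finiteness of [Pi] is a proved fact, not part of its type; the measure is repackaged to
   carry it. *)
pose nu : {sigma_finite_measure set R -> \bar R} :=
  HB.pack_for (SigmaFiniteMeasure.type R R) (Measure.sort Pi)
    (isSFinite.Build _ _ _ _ (sfinite_measure_sigma_finite sigma_finite_Pi))
    (isSigmaFinite.Build _ _ _ _ sigma_finite_Pi).
apply: (measurableT_comp (@fine_measurable _ _ _)) => //.
exact: (measurable_tail_measure nu).
Qed.

Let e_bound (s x : R) : 0 < s -> 0 < x -> 0 <= 1 - expR (- (s * x)) <= Num.min 1 (s * x).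
Proof.
move=> s0 x0; apply/andP; split.
  by rewrite subr_ge0 -[leRHS]expR0 ler_expR oppr_le0 mulr_ge0 ?ltW.
by rewrite le_min gerBl expR_ge0/= lerBlDl -lerBlDr expR_ge1Dx.
Qed.

Let measurable_e (s : R) : measurable_fun setT (fun x : R => 1 - expR (- (s * x))).
Proof. by apply: measurable_funB => //; exact: measurable_expRN. Qed.

Let int_1B_lty (s : R) : 0 < s ->
  (\int[Pi]_(x in I) (1 - expR (- (s * x)))%:E < +oo)%E.
Proof.
move=> s0.
have me (D : set R) : measurable D ->
    measurable_fun D (fun x : R => (1 - expR (- (s * x)))%:E).
  by move=> mD; apply/measurable_EFinP/measurable_funTS.
rewrite /I (@itv_bndbnd_setU _ _ _ (BLeft 1)); last 2 first.
- by rewrite bnd_simp.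
- by [].
rewrite ge0_integral_setU//=; last 3 first.
- by apply: me; exact: measurableU.
- move=> x /=; rewrite !in_itv/= andbT => xx.
  have x0 : 0 < x by case: xx => [/andP[]//|]; exact: lt_le_trans.
  by have /andP[] := e_bound s0 x0.
- apply/disj_setPS => y [/=]; rewrite 2!in_itv/= => /andP[_ y1] /andP[].
  by rewrite leNgt y1.
apply: lte_add_pinfty.
  apply: (@le_lt_trans _ _ (s%:E * \int[Pi]_(x in `]0%R, 1%R[) x%:E)%E); last first.
    by rewrite lte_mul_pinfty// lee_fin ltW.
  rewrite -ge0_integralZl//; last 2 first.
  - by move=> x /=; rewrite in_itv/= => /andP[x0 _]; rewrite lee_fin ltW.
  - by rewrite lee_fin ltW.
  apply: ge0_le_integral => //.
  - move=> x /=; rewrite in_itv/= => /andP[x0 _].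
    by have /andP[] := e_bound s0 x0.
  - exact: me.
  - exact: measurable_funeM.
  - move=> x /=; rewrite in_itv/= => /andP[x0 _]; rewrite -EFinM lee_fin.
    by have /andP[_] := e_bound s0 x0; rewrite le_min => /andP[].
apply: (@le_lt_trans _ _ (\int[Pi]_(x in `[1%R, +oo[) (cst 1 x)%E)%E).
  apply: ge0_le_integral => //.
  - move=> x /=; rewrite in_itv/= andbT => x1.
    by have /andP[] := e_bound s0 (lt_le_trans ltr01 x1).
  - exact: me.
  - move=> x /=; rewrite in_itv/= andbT => x1; rewrite lee_fin.
    have /andP[_] := e_bound s0 (lt_le_trans ltr01 x1).
    by rewrite le_min => /andP[].
rewrite integral_cst// mul1e.
(* [tail_lty] concerns open half-lines, so [1, +oo[ is enclosed in ]1/2, +oo[. *)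
apply: le_lt_trans (@tail_lty 2^-1 _); last by rewrite invr_gt0.
apply: le_measure; rewrite ?inE//; apply: subset_itvr; rewrite bnd_simp.
by rewrite invf_lt1// ltr1n.
Qed.

(** As x is integrable on ]0, 1[, the compensator can be integrated separately; it joins gamma to
    form the drift [delta], and the remaining integral of 1 - e^(-s x) becomes s times the transform
    of the tail. *)
Lemma levy_khintchine_bv : exists (delta : R) (tau : R -> R),
  forall s, 0 < s ->
    levy_khintchine gamma 0 Pi s = delta * s - s * tau s /\
    (\int[mu]_(x in `]0%R, +oo[) (expR (- (s * x)) * tail Pi x)%:E = (tau s)%:E)%E.
Proof.
pose J := \int[Pi]_(x in I) (x * \1_(`]0, 1[ : set R) x).
exists (gamma + J).
exists (fun s => fine (\int[mu]_(x in `]0%R, +oo[) (expR (- (s * x)) * tail Pi x)%:E)%E) => s s0.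
pose nu : {sigma_finite_measure set R -> \bar R} :=
  HB.pack_for (SigmaFiniteMeasure.type R R) (Measure.sort Pi)
    (isSFinite.Build _ _ _ _ (sfinite_measure_sigma_finite sigma_finite_Pi))
    (isSigmaFinite.Build _ _ _ _ sigma_finite_Pi).
have mt : measurable_fun setT (fun x : R => expR (- (s * x)) * tail Pi x).
  by apply: measurable_funM; [exact: measurable_expRN|exact: measurable_tail].
have t0 (x : R) : (0 <= (expR (- (s * x)) * tail Pi x)%:E)%E.
  by rewrite lee_fin mulr_ge0 ?expR_ge0 ?tail_ge0.
have E : (\int[Pi]_(x in I) (1 - expR (- (s * x)))%:E =
    s%:E * \int[mu]_(x in `]0%R, +oo[) (expR (- (s * x)) * tail Pi x)%:E)%E.
  rewrite -ge0_integralZl//; last 2 first.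
  - exact/measurable_EFinP/measurable_funTS.
  - by rewrite lee_fin ltW.
  rewrite (@integral_1BexpR_tail _ nu s s0); apply: eq_integral => y.
  rewrite inE/= in_itv/= andbT => y0.
  by rewrite -(tailE y0) -!EFinM mulrA.
set L := (\int[mu]_(x in _) _)%E in E *.
have Lfin : L \is a fin_num.
  rewrite ge0_fin_numE ?integral_ge0//.
  have : (s%:E * L < +oo)%E by rewrite -E; exact: int_1B_lty.
  by apply: contraTT; rewrite -!leNgt !leye_eq => /eqP ->; rewrite gt0_muley ?lte_fin.
split; last by rewrite fineK.
have mI : measurable I by exact: measurable_itv.
have ie : Pi.-integrable I (EFin \o (fun x => 1 - expR (- (s * x)))).
  apply/integrableP; split; first by apply/measurable_EFinP/measurable_funTS.
  apply: le_lt_trans (int_1B_lty s0); apply: ge0_le_integral => //.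
  - by apply: measurableT_comp => //; apply/measurable_EFinP/measurable_funTS.
  - by apply/measurable_EFinP/measurable_funTS.
  - move=> x; rewrite /I /= in_itv/= andbT => x0.
    by have /andP[h _] := e_bound s0 x0; rewrite ger0_norm.
have mx1 : measurable_fun setT (fun x : R => x * \1_(`]0, 1[ : set R) x).
  by apply: measurable_funM => //; exact: measurable_indic.
have ix : Pi.-integrable I (EFin \o (fun x : R => x * \1_(`]0, 1[ : set R) x)).
  apply/integrableP; split; first exact/measurable_EFinP/measurable_funTS.
  apply: le_lt_trans int_x_lty; rewrite [leLHS]integral_mkcond [leRHS]integral_mkcond.
  rewrite le_eqVlt; apply/orP; left; apply/eqP; apply: eq_integral => x _.
  rewrite !patchE /I /= indicE !mem_setE !in_itv/= andbT.
  have [x0|x0]/= := ltP 0 x => //.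
  by case: ifP => _; rewrite /= ?mulr1 ?mulr0 ?normr0// gtr0_norm.
rewrite /levy_khintchine -/I expr0n/= mulr0 mul0r addr0.
have -> : \int[Pi]_(x in I) (1 - expR (- (s * x)) - s * x * \1_(`]0, 1[ : set R) x) =
    \int[Pi]_(x in I) (1 - expR (- (s * x))) - s * J.
  have isx := @integrableZl _ _ _ Pi I (measurable_itv _) s _ ix.
  rewrite /J -RintegralZl// -RintegralB//.
  by apply: eq_Rintegral => x _; rewrite mulrA.
have -> : \int[Pi]_(x in I) (1 - expR (- (s * x))) = s * fine L.
  by rewrite /Rintegral E -(fineK Lfin) -EFinM.
ring.
Qed.

End LevyBoundedVariation.

Lemma scale_function_smooth (R : realType) (gamma : R)
    (Pi : {measure set R -> \bar R}) (W : R -> R -> R) (q : R) :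
  levy_measure Pi -> (\int[Pi]_(x in `]0%R, 1%R[) x%:E < +oo)%E ->
  (forall p : R, 0 <= p -> scale_function (levy_khintchine gamma 0 Pi) p (W p)) ->
  0 <= q -> C1_pos (W q) <-> C0_pos (tail Pi).
Proof.
move=> levyPi int_x W_scale q0.
have [delta [tau rep]] := levy_khintchine_bv gamma levyPi int_x.
have q10 : 0 <= q + 1 by lra.
have [Wneg Wge0 Wcont Wnd lapW] := W_scale q q0.
have [_ W1ge0 _ _ lapW1] := W_scale (q + 1) q10.
pose psi := levy_khintchine gamma 0 Pi.
pose s1 := Num.max 0 (Num.max (Phi psi q) (Phi psi (q + 1))).
have s1_ge0 : 0 <= s1 by rewrite le_max lexx.
have s1P s : s1 < s -> [/\ 0 < s, Phi psi q < s & Phi psi (q + 1) < s].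
  by rewrite /s1 !gt_max => /and3P[].
(* The transform of [W q] itself would only give psi - q >= 0, as 0^-1 = 0 here. That of [W (q + 1)]
   gives psi - q >= 1, and positivity of [delta] follows in turn. *)
have psi_gt s : s1 < s -> 0 < delta * s - s * tau s - q.
  move=> /s1P[s0 _ sq1]; have [<- _] := rep s s0.
  suff : 0 <= psi s - (q + 1) by rewrite /psi; lra.
  rewrite -invr_ge0 -lee_fin -lapW1//.
  by apply: integral_ge0 => x _; rewrite lee_fin mulr_ge0// expR_ge0.
have tau_ge0 s : 0 < s -> 0 <= tau s.
  move=> s0; have [_ E] := rep s s0; rewrite -lee_fin -E.
  by apply: integral_ge0 => x _; rewrite lee_fin mulr_ge0 ?expR_ge0// tail_ge0.
have delta0 : 0 < delta.
  have s1s : s1 < s1 + 1 by rewrite ltrDl.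
  have [s0 _ _] := s1P _ s1s; have h1 := psi_gt _ s1s; have h2 := tau_ge0 _ s0.
  have : 0 <= (s1 + 1) * tau (s1 + 1) by rewrite mulr_ge0// ltW.
  by rewrite -(pmulr_lgt0 _ s0); lra.
apply: (@scale_smooth_iff _ (tail Pi) (W q) tau q delta s1) => //.
- exact: measurable_tail.
- exact: tail_ge0.
- exact: tail_noninc.
- by move=> s /s1P[s0 _ _]; case: (rep s s0).
- move=> s /s1P[s0 sq _]; rewrite lapW//.
  by have [-> _] := rep s s0.
Qed.

(** * Independence of the increments *)

Section Independence.
Context d (T : measurableType d) (R : realType) (P : probability T R).
Local Open Scope ereal_scope.

Import HBNNSimple.

(** Simple functions and monotone convergence. The constant [c] is an extended real because it will
    be a product of expectations such as that of e^(theta X), not yet known to be finite. *)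
Lemma integral_mul_comp_indic (G Y : T -> R) (c : \bar R) (f : R -> R) :
  measurable_fun setT G -> (forall w, 0 <= G w)%R -> measurable_fun setT Y ->
  0 <= c ->
  (forall B : set R, measurable B ->
    \int[P]_w (G w * \1_B (Y w))%:E = c * P (Y @^-1` B)) ->
  measurable_fun setT f -> (forall x, 0 <= f x)%R ->
  \int[P]_w (G w * f (Y w))%:E = c * \int[P]_w (f (Y w))%:E.
Proof.
move=> mG G0 mY c0 indB mf f0.
have mfE : measurable_fun setT (EFin \o f) by exact/measurable_EFinP.
pose g := nnsfun_approx measurableT mfE.
have mgY n : measurable_fun setT (fun w => g n (Y w)) by exact: measurableT_comp.
have mYB r n : measurable (Y @^-1` (g n @^-1` [set r])).
  by rewrite -[X in measurable X]setTI; exact: mY.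
have simple n : \int[P]_w (G w * g n (Y w))%:E = c * \int[P]_w (g n (Y w))%:E.
  have expand (H : T -> R) w : (H w * g n (Y w))%:E =
      \sum_(r \in range (g n)) (r%:E * (H w * \1_(g n @^-1` [set r]) (Y w))%:E).
    rewrite (fsbigD1 (g n (Y w)))//=; last by exists (Y w).
    rewrite indicE mem_set// mulr1 fsbig1 ?adde0; first by rewrite -EFinM mulrC.
    by move=> r [_ /= /nesym rY]; rewrite indicE memNset// mulr0 mule0.
  have step (H : T -> R) : measurable_fun setT H -> (forall w, 0 <= H w)%R ->
      \int[P]_w (H w * g n (Y w))%:E = \sum_(r \in range (g n))
        (r%:E * \int[P]_w (H w * \1_(g n @^-1` [set r]) (Y w))%:E).
    move=> mH H0.
    have mHi r : measurable_fun setT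
        (fun w => (H w * \1_(g n @^-1` [set r]) (Y w))%:E).
      apply/measurable_EFinP; apply: measurable_funM => //.
      exact: (@measurable_indic _ _ R setT (Y @^-1` (g n @^-1` [set r])) (mYB r n)).
    have rH0 r w : 0 <= r%:E * (H w * \1_(g n @^-1` [set r]) (Y w))%:E.
      have [r0|r0] := leP 0%R r.
        by rewrite mule_ge0// lee_fin mulr_ge0.
      by rewrite preimage_nnfun0// indic0 mulr0 mule0.
    under eq_integral do rewrite expand.
    rewrite ge0_integral_fsum//; last by move=> r; exact: measurable_funeM.
    apply: eq_fsbigr => r _; have [r0|r0] := leP 0%R r.
      by rewrite ge0_integralZl// => w _; rewrite lee_fin mulr_ge0.
    rewrite preimage_nnfun0//; under eq_integral do rewrite indic0 mulr0 mule0.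
    by under [in RHS]eq_integral do rewrite indic0 mulr0; rewrite !integral0 mule0.
  have step1 := step (cst 1%R) (measurable_cst _) (fun=> ler01).
  under [in RHS]eq_integral do rewrite -[g n _]mul1r.
  rewrite step// step1 ge0_mule_fsumr.
    apply: eq_fsbigr => r _; rewrite indB//.
    rewrite muleCA; congr (_ * (_ * _)).
    under [RHS]eq_integral do rewrite mul1r.
    have := @integral_indic _ T R P setT measurableT (Y @^-1` (g n @^-1` [set r])) (mYB r n).
    by rewrite setIT => <-.
  move=> r; have [r0|r0] := leP 0%R r.
    by rewrite mule_ge0// integral_ge0// => w _; rewrite lee_fin mulr_ge0.
  rewrite preimage_nnfun0//; under eq_integral do rewrite indic0 mulr0.
  by rewrite integral0 mule0.
have cvG : \int[P]_w (G w * g n (Y w))%:E @[n --> \oo] --> \int[P]_w (G w * f (Y w))%:E.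
  have -> : \int[P]_w (G w * f (Y w))%:E =
      \int[P]_w limn (fun n => (G w * g n (Y w))%:E).
    apply: eq_integral => w _; apply/esym/cvg_lim => //.
    under eq_fun do rewrite EFinM.
    rewrite EFinM; apply: cvgeZl => //.
    by apply: cvg_nnsfun_approx => // x _; rewrite lee_fin.
  apply: cvg_monotone_convergence => //.
  - by move=> n; apply/measurable_EFinP; exact: measurable_funM.
  - by move=> n w _; rewrite lee_fin mulr_ge0.
  - move=> w _ a b ab; rewrite lee_fin ler_wpM2l//.
    exact/lefP/nd_nnsfun_approx.
have cvY : \int[P]_w (g n (Y w))%:E @[n --> \oo] --> \int[P]_w (f (Y w))%:E.
  have -> : \int[P]_w (f (Y w))%:E = \int[P]_w limn (fun n => (g n (Y w))%:E).
    apply: eq_integral => w _; apply/esym/cvg_lim => //.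
    by apply: cvg_nnsfun_approx => // x _; rewrite lee_fin.
  apply: cvg_monotone_convergence => //.
  - by move=> n; exact/measurable_EFinP.
  - by move=> n w _; rewrite lee_fin.
  - by move=> w _ a b ab; rewrite lee_fin; exact/lefP/nd_nnsfun_approx.
have cvcY : c * \int[P]_w (g n (Y w))%:E @[n --> \oo] --> c * \int[P]_w (f (Y w))%:E.
  have [cfin|] := boolP (c \is a fin_num); first exact: cvgeZl.
  rewrite ge0_fin_numE// -leNgt leye_eq => /eqP ->.
  (* For c = +oo multiplication is discontinuous at 0; if the limit is 0, all the approximating
     integrals are 0 as well. *)
  have [I0|I0] := eqVneq (\int[P]_w (f (Y w))%:E) 0.
    have I0n n : \int[P]_w (g n (Y w))%:E = 0.
      apply/eqP; rewrite eq_le integral_ge0 ?andbT; last by move=> w _; rewrite lee_fin.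
      rewrite -I0; apply: ge0_le_integral => //.
      - by move=> w _; rewrite lee_fin.
      - exact/measurable_EFinP.
      - by apply/measurable_EFinP; exact: measurableT_comp.
      - move=> w _; rewrite /g nnsfun_approxE.
        by apply: (@le_approx _ _ _ setT (EFin \o f)) => // x _; rewrite lee_fin.
    by under eq_fun do rewrite I0n; rewrite I0 mule0; exact: cvg_cst.
  apply: cvgeM => //; last exact: cvg_cst.
  apply: neq0_mule_def; rewrite gt0_mulye// lt0e I0 integral_ge0// => w _.
  by rewrite lee_fin.
have cvG' : c * \int[P]_w (g n (Y w))%:E @[n --> \oo] --> \int[P]_w (G w * f (Y w))%:E.
  rewrite (_ : (fun n => c * _) = fun n => \int[P]_w (G w * g n (Y w))%:E)//.
  by apply/funext => n; rewrite simple.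
exact: cvg_unique cvG' cvcY.
Qed.

Let indep_family (Y : nat -> T -> R) n :=
  forall B : nat -> set R, (forall i, measurable (B i)) ->
    P (\bigcap_(i in `I_n) [set w | B i (Y i w)]) =
    \prod_(i < n) P [set w | B i (Y i w)].

(* The factors are replaced one by one by indicators, for which independence applies. *)
Let integral_prod_aux (Y : nat -> T -> R) n k (g : nat -> R -> R) :
  (forall i, measurable_fun setT (Y i)) -> indep_family Y n ->
  (forall i, measurable_fun setT (g i)) -> (forall i x, (0 <= g i x)%R) ->
  (forall i, (k <= i < n)%N -> exists2 B : set R, measurable B & g i = \1_B) ->
  \int[P]_w (\prod_(i < n) g i (Y i w))%:E = \prod_(i < n) \int[P]_w (g i (Y i w))%:E.
Proof.
move=> mY indY; elim: k g => [|k IH] g mg g0 gB.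
  have /choice[B BP] : forall i, exists B : set R,
      measurable B /\ ((i < n)%N -> g i = \1_B).
    move=> i; have [ni|ni] := ltnP i n; last by exists setT.
    by have [B mB gBi] := gB i ni; exists B.
  have mB i : measurable (B i) by have [] := BP i.
  have gE (i : 'I_n) : g i = \1_(B i) by have [_] := BP i; apply.
  have mYB i : measurable [set w | B i (Y i w)].
    by rewrite -[X in measurable X]setTI; exact: mY.
  have mcap : measurable (\bigcap_(i in `I_n) [set w | B i (Y i w)]).
    by apply: bigcap_measurableType => // i _.
  transitivity (\int[P]_w (\1_(\bigcap_(i in `I_n) [set w | B i (Y i w)]) w)%:E).
    apply: eq_integral => w _; congr EFin.
    under eq_bigr do rewrite gE indicE.
    rewrite indicE; have [wB|/existsNP[i /not_implyP[ni wBi]]] :=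
        pselect (forall i, `I_n i -> B i (Y i w)).
      rewrite mem_set// big1// => i _; rewrite mem_set//; exact: (wB _ (ltn_ord i)).
    rewrite memNset; last by move=> /(_ i ni).
    by rewrite (bigD1 (Ordinal ni))//= memNset// mul0r.
  have := @integral_indic _ T R P setT measurableT _ mcap; rewrite setIT => ->.
  apply: etrans (indY B mB) _; apply: eq_bigr => i _.
  rewrite gE; have := @integral_indic _ T R P setT measurableT _ (mYB i).
  by rewrite setIT => <-.
have [kn|nk] := ltnP k n; last first.
  apply: IH => // i /andP[ki]; rewrite ltnNge => /negP; case.
  exact: leq_trans ki.
pose ko := Ordinal kn.
pose G w := (\prod_(i < n | i != ko) g i (Y i w))%R.
pose c := \prod_(i < n | i != ko) \int[P]_w (g i (Y i w))%:E.
have mG : measurable_fun setT G.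
  rewrite /G; under eq_fun do rewrite -big_filter.
  by apply: measurable_prod => i _; exact: measurableT_comp.
have G0 w : (0 <= G w)%R by apply: prodr_ge0.
have c0 : 0 <= c.
  by apply: prode_ge0 => i _; apply: integral_ge0 => w _; rewrite lee_fin.
transitivity (\int[P]_w (G w * g k (Y k w))%:E).
  by apply: eq_integral => w _; rewrite (bigD1 ko)//= mulrC.
rewrite (@integral_mul_comp_indic G (Y k) c)//; first by rewrite [RHS](bigD1 ko)//= muleC.
move=> B mB.
(* With factor k replaced by an indicator the induction hypothesis applies; its conclusion, for
   every [B], is the hypothesis of [integral_mul_comp_indic]. *)
pose g' i := if i == k then \1_B else g i.
have g'E (i : 'I_n) : i != ko -> g' i = g i.
  by move=> ik; rewrite /g' ifF//; apply: contraNF ik => /eqP ik; apply/eqP/val_inj.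
have := IH g'; rewrite (bigD1 ko)//=.
have -> : \prod_(i < n | i != ko) \int[P]_w (g' i (Y i w))%:E = c.
  by apply: eq_bigr => i ik; rewrite g'E.
have -> : \int[P]_w (\prod_(i < n) g' i (Y i w))%:E = \int[P]_w (G w * \1_B (Y k w))%:E.
  apply: eq_integral => w _; rewrite (bigD1 ko)//= mulrC; congr (_ * _)%:E.
    by apply: eq_bigr => i ik; rewrite g'E.
  by rewrite /g' eqxx.
have mYB : measurable (Y k @^-1` B) by rewrite -[X in measurable X]setTI; exact: mY.
have -> : \int[P]_w (g' k (Y k w))%:E = P (Y k @^-1` B).
  rewrite /g' eqxx; have := @integral_indic _ T R P setT measurableT _ mYB.
  by rewrite setIT => <-.
rewrite muleC; apply.
- by move=> i; rewrite /g'; case: ifP => // _; exact: measurable_indic.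
- by move=> i x; rewrite /g'; case: ifP.
- move=> i /andP[ki ni]; rewrite /g'; case: ifP => [_|/negbT ik]; first by exists B.
  by apply: gB; rewrite ni andbT ltn_neqAle eq_sym ik.
Qed.

Lemma integral_prod_independent (Y : nat -> T -> R) n (f : R -> R) :
  (forall i, measurable_fun setT (Y i)) ->
  (forall B : nat -> set R, (forall i, measurable (B i)) ->
    P (\bigcap_(i in `I_n) [set w | B i (Y i w)]) =
    \prod_(i < n) P [set w | B i (Y i w)]) ->
  measurable_fun setT f -> (forall x, (0 <= f x)%R) ->
  \int[P]_w (\prod_(i < n) f (Y i w))%:E = \prod_(i < n) \int[P]_w (f (Y i w))%:E.
Proof.
move=> mY indY mf f0; apply: (@integral_prod_aux Y n n (fun=> f)) => // i.
by move=> /andP[ni]; rewrite ltnNge ni.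
Qed.

Lemma eq_integral_same_law (X Y : {RV P >-> R}) (f : R -> R) :
  (forall B : set R, measurable B -> P [set w | B (X w)] = P [set w | B (Y w)]) ->
  measurable_fun setT f -> (forall x, (0 <= f x)%R) ->
  \int[P]_w (f (X w))%:E = \int[P]_w (f (Y w))%:E.
Proof.
move=> XY mf f0.
have mfE : measurable_fun setT (EFin \o f) by exact/measurable_EFinP.
have h (Z : {RV P >-> R}) :
    \int[P]_w (f (Z w))%:E = \int[distribution P Z]_x (f x)%:E.
  by rewrite (@ge0_integral_distribution _ _ _ _ _ P Z (EFin \o f))// => y; rewrite lee_fin.
by rewrite !h; apply: eq_measure_integral => B mB _; exact: XY.
Qed.

End Independence.

(** * Paths of bounded variation *)

(* With [l] of order [h^(-1/2)], the last term is negligible in front of [h]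
   for the increment over a time [h]. *)
Lemma expR_truncation (R : realType) (theta l x : R) : 1 <= theta -> 2 * theta <= l ->
  expR (theta * x) <=
    1 + 4 * theta * (1 - expR (- `|x|)) + expR (l * x) * expR (- (l / (4 * theta))).
Proof.
move=> t1 l2.
have t0 : 0 < theta by lra.
have e1 : expR (- `|x|) <= 1 by rewrite -[leRHS]expR0 ler_expR oppr_le0.
have p1 : 0 <= 4 * theta * (1 - expR (- `|x|)).
  by rewrite mulr_ge0 ?subr_ge0// mulr_ge0// ltW.
have p2 : 0 <= expR (l * x) * expR (- (l / (4 * theta))) by rewrite mulr_ge0// expR_ge0.
have [x0|x0] := leP x 0.
  have : expR (theta * x) <= 1 by rewrite -[leRHS]expR0 ler_expR pmulr_rle0.
  lra.
(* Up to 1 / (2 theta), the constant 4 is 2 times 2: e^u <= 1 + 2 u for u = theta x <= 1/2, and x <=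
   2 (1 - e^(-x)) for x <= 1. *)
have [xt|xt] := leP x (2 * theta)^-1.
  have u2 : theta * x <= 2^-1.
    by move: xt; rewrite invfM -ler_pdivlMl// mulrC.
  have u0 : 0 <= theta * x by rewrite mulr_ge0 ?ltW.
  have eu : expR (theta * x) <= 1 + 2 * (theta * x).
    have h1 := expR_ge1Dx (- (theta * x)).
    have h2 : expR (theta * x) * expR (- (theta * x)) = 1 by rewrite -expRD subrr expR0.
    have h3 := expR_gt0 (theta * x).
    have : expR (theta * x) * (1 - theta * x) <= 1 by rewrite -[leRHS]h2 ler_wpM2l// ltW.
    nra.
  have x1 : x <= 1 by nra.
  have ex : x / 2 <= 1 - expR (- x).
    have h1 := expR_ge1Dx x.
    have h2 : expR x * expR (- x) = 1 by rewrite -expRD subrr expR0.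
    have h3 := expR_gt0 (- x).
    have : (1 + x) * expR (- x) <= 1 by rewrite -[leRHS]h2 ler_wpM2r// ltW.
    nra.
  rewrite gtr0_norm//.
  move: p1; rewrite gtr0_norm// => p1.
  have : 4 * theta * (x / 2) <= 4 * theta * (1 - expR (- x)) by rewrite ler_wpM2l// mulr_ge0// ltW.
  lra.
(* Here l - theta >= l / 2 and x > 1 / (2 theta), so (l - theta) x >= l / (4 theta). *)
have : expR (theta * x) <= expR (l * x) * expR (- (l / (4 * theta))).
  rewrite -expRD ler_expR.
  suff : l / (4 * theta) <= (l - theta) * x by lra.
  have -> : l / (4 * theta) = l / 2 * (2 * theta)^-1 by field; rewrite gt_eqF.
  by apply: ler_pM; rewrite ?invr_ge0 ?divr_ge0 ?mulr_ge0//; lra.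
lra.
Qed.

(** * Expectations over increments of equal length *)

Section ProcessIncrements.
Context (R : realType) d (T : measurableType d) (P : probability T R)
  (X : R -> {RV P >-> R}).
Hypothesis X_levy : levy_process X.

Let t N i : R := i%:R / N.+1%:R.
Let Y N i w : R := X (t N i.+1) w - X (t N i) w.

Let t_ge0 N i : 0 <= t N i. Proof. by rewrite divr_ge0. Qed.

Let mY N i : measurable_fun setT (Y N i).
Proof. by apply: measurable_funB. Qed.

Local Open Scope ereal_scope.

Lemma integral_prod_increments N (f : R -> R) :
  measurable_fun setT f -> (forall x, (0 <= f x)%R) ->
  \int[P]_w (\prod_(i < N.+1) f (Y N i w))%:E =
  (\int[P]_w (f (X N.+1%:R^-1 w))%:E) ^+ N.+1.
Proof.
move=> mf f0; have [_ _ indep stat] := X_levy.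
have prod_const (c : \bar R) n : \prod_(i < n) c = c ^+ n.
  by elim: n => [|n IH]; rewrite ?big_ord0// big_ord_recl IH -expeS.
rewrite integral_prod_independent//; last first.
  move=> B mB; apply: indep => // i j ij.
  by rewrite ler_wpM2r ?invr_ge0// ler_nat.
rewrite -prod_const; apply: eq_bigr => i _.
apply: (@eq_integral_same_law _ _ _ P (X (t N i.+1) - X (t N i))%R (X N.+1%:R^-1)) => //.
move=> B mB; rewrite -(stat (t N i) (N.+1%:R^-1)%R)//.
have -> : (t N i.+1 = t N i + N.+1%:R^-1)%R by rewrite /t -natr1 mulrDl mul1r.
by [].
Qed.

(** The triplet fixes the law at time 1 only. The product over N + 1 increments telescopes to
    e^(theta X_1), so the power N + 1 of the expectation is e^psi; an infinite expectation would
    have an infinite power, and nonnegative roots are unique. *)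
Lemma integral_expR_increment (gamma sigma : R) (Pi : {measure set R -> \bar R}) N theta :
  levy_triplet gamma sigma Pi X -> (0 <= theta)%R ->
  \int[P]_w (expR (theta * X N.+1%:R^-1 w))%:E =
  (expR (levy_khintchine gamma sigma Pi theta / N.+1%:R))%:E.
Proof.
move=> [_ _ trip] t0; set psi := levy_khintchine _ _ _ _.
have [X0 _ _ _] := X_levy.
pose f (x : R) := expR (theta * x).
have mf : measurable_fun setT f by apply: measurableT_comp => //; exact: measurable_funM.
have f0 x : (0 <= f x)%R by exact: expR_ge0.
have E1 : \int[P]_w (expR (theta * X 1%R w))%:E = (expR psi)%:E.
  have := trip theta t0; rewrite unlock -/psi => /(congr1 (@expeR R)).
  by rewrite lneK//= in_itv/= leey integral_ge0// => w _; rewrite lee_fin expR_ge0.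
have := integral_prod_increments N mf f0.
have -> : \int[P]_w (\prod_(i < N.+1) f (Y N i w))%:E = \int[P]_w (expR (theta * X 1%R w))%:E.
  apply: ae_eq_integral => //.
  - apply/measurable_EFinP; apply: measurable_prod => i _.
    exact: measurableT_comp.
  - by apply/measurable_EFinP; apply: (measurableT_comp mf).
  - apply: filterS X0 => w Xw0 _; congr EFin; rewrite /f -expR_sum; congr expR.
    rewrite -mulr_sumr; congr (_ * _)%R.
    rewrite -(big_mkord xpredT (fun i => Y N i w)) /Y telescope_sumr//.
    by rewrite {2}/t mul0r Xw0 subr0 /t divff.
rewrite E1; set I := \int[P]_w (expR (theta * X N.+1%:R^-1 w))%:E => E2.
have I0 : 0 <= I by apply: integral_ge0 => w _; rewrite lee_fin expR_ge0.
have Ifin : I \is a fin_num.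
  rewrite ge0_fin_numE//; move: E2; case: (I) I0 => [r|//|//] _; first by rewrite ltry.
  by rewrite expeS gt0_mulye// ?expe_gt0.
rewrite -(fineK Ifin) in E2 *; move: E2; rewrite -EFin_expe => -[E2].
congr EFin.
have : (expR (psi / N.+1%:R) ^+ N.+1 = fine I ^+ N.+1)%R.
  by rewrite -E2 -expRM_natl mulrC divfK.
move/eqP; rewrite eqrXn2// ?expR_ge0 ?fine_ge0// => /eqP ->.
by [].
Qed.

Let V N w : R := (\sum_(i < N.+1) `|Y N i w|)%R.

Let V_le_variation N (w : T) M :
  (forall v, variations 0%R 1%R (X ^~ w) v -> v <= M)%R -> (V N w <= M)%R.
Proof.
move=> ubM.
pose s := [seq t N i.+1 | i <- iota 0 N.+1].
have t_mono i : (t N i < t N i.+1)%R by rewrite ltr_pM2r ?invr_gt0// ltr_nat.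
have s_size : size s = N.+1 by rewrite size_map size_iota.
have sE i : (i <= N.+1)%N -> nth 1%R (0%R :: s) i = t N i.
  case: i => [_|i iN]; first by rewrite /= /t mul0r.
  by rewrite /= (nth_map 0%N) ?size_iota// nth_iota.
have part : itv_partition 0%R 1%R s.
  split.
    apply/(pathP 1%R) => i; rewrite s_size => iN.
    by rewrite -[nth _ s i]/(nth 1%R (0%R :: s) i.+1) !sE// ltnW.
  by rewrite (last_nth 1%R) s_size sE// /t divff.
have := ubM _ (variations_variation (X ^~ w) part).
rewrite /variation s_size big_mkord; congr (_ <= _)%R.
apply: eq_bigr => i _ /=; rewrite /Y; congr `|_|%R.
have iN : (i < N.+1)%N by exact: ltn_ord.
rewrite -[nth _ s i]/(nth 1%R (0%R :: s) i.+1) !sE//; exact: ltnW.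
Qed.

(* On a set of positive probability all the sums [V N] are bounded by a constant. *)
Lemma integral_expR_norm_increment : bounded_variation_paths X ->
  exists2 C : R, (0 <= C)%R & forall N,
    \int[P]_w (1 - expR (- `|X N.+1%:R^-1 w|))%:E <= (C / N.+1%:R)%:E.
Proof.
move=> X_bv.
(* Only the uniform partitions are used: this is a countable intersection, hence measurable. Almost
   every path lies in some [A k], so one of them has positive probability. *)
pose A k := \bigcap_N [set w | (V N w <= k%:R)%R].
have mV N : measurable_fun setT (V N).
  by apply: measurable_sum => i; exact: measurableT_comp.
have mA k : measurable (A k).
  apply: bigcap_measurableType => N _.
  rewrite -[X in measurable X]setTI; apply: measurable_fun_ler => //.
have [k Ak0] : exists k, P (A k) != 0.
  apply: contrapT => /forallNP A0.
  have negA : P.-negligible (\bigcup_k A k).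
    apply: negligible_bigcup => k; apply/negligibleP => //.
    by have := A0 k; move/negP; rewrite negbK => /eqP.
  have : P.-negligible [set: T].
    apply: negligibleS (negligibleU X_bv negA) => w _.
    have [wbv|] := pselect (forall t, (0 <= t)%R -> bounded_variation 0%R t (X ^~ w)); last by left.
    right; have [M /= ubM] := wbv 1%R ler01.
    exists (Num.truncn `|M|).+1 => // N _ /=.
    apply: (@le_trans _ _ M).
      by apply: V_le_variation => v vv; exact: ubM.
    by rewrite (le_trans (ler_norm _))// ltW// truncnS_gt.
  move=> /(measure_negligible measurableT) PT0.
  have /eqP : 1 = 0 :> \bar R by rewrite -[LHS](@probability_setT _ _ _ P).
  by rewrite eqe oner_eq0.
have PAfin : P (A k) \is a fin_num by exact: fin_num_measure.
have PA1 : (0 < fine (P (A k)))%R by rewrite fine_gt0// lt0e Ak0 measure_ge0/= -ge0_fin_numE.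
(* A lower bound, uniform in N, for E(e^(-V N)), which by independence is the power N + 1 of the
   expectation for a single increment. *)
pose c := (expR (- k%:R) * fine (P (A k)))%R.
have c0 : (0 < c)%R by rewrite mulr_gt0// expR_gt0.
pose f (x : R) := expR (- `|x|).
have f0 x : (0 <= f x)%R by exact: expR_ge0.
have f1 x : (f x <= 1)%R by rewrite /f -[leRHS]expR0 ler_expR oppr_le0.
have mf : measurable_fun setT f.
  by apply: measurableT_comp => //; apply: measurable_funN; exact: normr_measurable.
have bound N : exists2 e : R,
    (0 <= e <= 1)%R /\ \int[P]_w (f (X N.+1%:R^-1 w))%:E = e%:E &
    (c <= e ^+ N.+1)%R.
  set I := \int[P]_w _.
  have mfX : measurable_fun setT (fun w => (f (X N.+1%:R^-1 w))%:E).
    by apply/measurable_EFinP; exact: measurableT_comp.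
  have I1 : I <= 1.
    apply: (@le_trans _ _ (\int[P]_w cst 1 w)).
      by apply: ge0_le_integral => // w _; rewrite lee_fin.
    by rewrite integral_cst// mul1e [leLHS](@probability_setT _ _ _ P).
  have I0 : 0 <= I by apply: integral_ge0 => w _; rewrite lee_fin.
  have Ifin : I \is a fin_num by rewrite ge0_fin_numE// (le_lt_trans I1)// ltry.
  exists (fine I); rewrite ?fineK//.
    by split=> //; rewrite -!lee_fin fineK// I0.
  rewrite -lee_fin EFin_expe fineK// -integral_prod_increments//.
  apply: (@le_trans _ _ (\int[P]_(w in A k) (expR (- k%:R))%:E)).
    by rewrite integral_cst// /c EFinM fineK.
  have prodE w : (\prod_(i < N.+1) f (Y N i w))%R = expR (- V N w).
    by rewrite /f -expR_sum sumrN.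
  under [leRHS]eq_integral do rewrite prodE.
  have mE : measurable_fun setT (fun w => (expR (- V N w))%:E).
    by apply/measurable_EFinP; apply: measurableT_comp => //; exact: measurable_funN.
  apply: (@le_trans _ _ (\int[P]_(w in A k) (expR (- V N w))%:E)).
    apply: ge0_le_integral => //.
    - exact: measurable_funTS.
    - by move=> w Aw; rewrite lee_fin ler_expR lerN2; exact: (Aw N Logic.I).
  exact: ge0_subset_integral.
(* From c <= e^(N+1) <= exp(-(1 - e)(N + 1)), where e is the expectation for one increment. *)
exists (- ln c)%R.
  have [e [/andP[e0 e1] _] ce] := bound 0%N.
  by rewrite oppr_ge0 ln_le0// (le_trans ce)// expr1.
move=> N; have [e [/andP[e0 e1] eE] ce] := bound N.
have -> : \int[P]_w (1 - expR (- `|X N.+1%:R^-1 w|))%:E = (1 - e)%:E.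
  have mfX : measurable_fun setT (fun w => f (X N.+1%:R^-1 w)) by exact: measurableT_comp.
  have : \int[P]_w (1 - f (X N.+1%:R^-1 w))%:E + \int[P]_w (f (X N.+1%:R^-1 w))%:E = 1.
    rewrite -ge0_integralD//.
    - under eq_integral do rewrite -EFinD subrK.
      by rewrite integral_cst// mul1e [LHS](@probability_setT _ _ _ P).
    - by move=> w _; rewrite lee_fin subr_ge0.
    - by apply/measurable_EFinP; exact: measurable_funB.
    - by move=> w _; rewrite lee_fin.
    - exact/measurable_EFinP.
  rewrite eE => /(congr1 (fun z => z - e%:E)); rewrite addeK// => ->.
rewrite lee_fin ler_pdivlMr//.
have : (c <= expR (- ((1 - e) * N.+1%:R)))%R.
  apply: le_trans ce _; rewrite -mulNr mulrC expRM_natl.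
  rewrite lerXn2r ?nnegrE ?expR_ge0//.
  by have := expR_ge1Dx (- (1 - e)); lra.
rewrite -[leLHS]lnK ?posrE// ler_expR; lra.
Qed.

End ProcessIncrements.

(** * From small-time increments to linear growth of the exponent *)

Section BoundedVariation.
Context (R : realType) d (T : measurableType d) (P : probability T R)
  (X : R -> {RV P >-> R}) (gamma sigma : R) (Pi : {measure set R -> \bar R}).
Hypotheses (X_levy : levy_process X) (X_triplet : levy_triplet gamma sigma Pi X).
Local Notation psi := (levy_khintchine gamma sigma Pi).

(** Expectation of [expR_truncation] at time h = 1/m^2 with l = m: the middle term is O(h) by
    hypothesis, and E(e^(m X_h)) = e^(psi(m)/m^2) <= e^A. *)
Let increment_estimate (C A theta : R) (m : nat) : 1 <= theta -> 2 * theta <= m%:R ->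
  (forall N, (\int[P]_w (1 - expR (- `|X N.+1%:R^-1 w|))%:E <= (C / N.+1%:R)%:E)%E) ->
  (forall l, 1 <= l -> psi l <= A * l ^+ 2) ->
  expR (psi theta / m%:R ^+ 2) <=
    1 + 4 * theta * (C / m%:R ^+ 2) + expR A * expR (- (m%:R / (4 * theta))).
Proof.
move=> t1 mt CN psiA.
have m0 : 0 < m%:R :> R by lra.
have m1 : 1 <= m%:R :> R by lra.
have t0 : 0 <= theta by lra.
have mN : ((m ^ 2).-1).+1 = (m ^ 2)%N by rewrite prednK// expn_gt0 -(ltr_nat R) m0.
have mNR : ((m ^ 2).-1).+1%:R = m%:R ^+ 2 :> R by rewrite mN natrX.
set N := (m ^ 2).-1 in mN mNR.
have := integral_expR_increment X_levy N X_triplet t0; rewrite mNR => Et.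
have := integral_expR_increment X_levy N X_triplet (ltW m0); rewrite mNR => Em.
have := CN N; rewrite mNR => {}CN.
pose Z : {RV P >-> R} := X (m%:R ^+ 2)^-1.
rewrite -/Z in Et Em CN.
have mexp (a : R) : measurable_fun setT (fun w => expR (a * Z w)).
  by apply: measurableT_comp => //; exact: measurable_funM.
have mD : measurable_fun setT (fun w => 1 - expR (- `|Z w|)).
  apply: measurable_funB => //; apply: measurableT_comp => //.
  by apply: measurable_funN; exact: measurableT_comp.
have D0 w : 0 <= 1 - expR (- `|Z w|).
  by rewrite subr_ge0 -[leRHS]expR0 ler_expR oppr_le0.
set D := (\int[P]_w (1 - _)%:E)%E in CN.
have D_ge0 : (0 <= D)%E by apply: integral_ge0 => w _; rewrite lee_fin.
have Dfin : D \is a fin_num by rewrite ge0_fin_numE// (le_lt_trans CN)// ltry.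
have : ((expR (psi theta / m%:R ^+ 2))%:E <=
    1 + ((4 * theta)%:E * D + (expR (- (m%:R / (4 * theta))))%:E * (expR (psi m%:R / m%:R ^+ 2))%:E))%E.
  have t4 : 0 <= 4 * theta by rewrite mulr_ge0.
  pose F1 w := 4 * theta * (1 - expR (- `|Z w|)).
  pose F2 w := expR (m%:R * Z w) * expR (- (m%:R / (4 * theta))).
  have mF1 : measurable_fun setT F1 by exact: measurable_funM.
  have mF2 : measurable_fun setT F2 by exact: measurable_funM.
  have F1_ge0 w : 0 <= F1 w by rewrite mulr_ge0.
  have F2_ge0 w : 0 <= F2 w by rewrite mulr_ge0// expR_ge0.
  have I1 : (\int[P]_w (F1 w)%:E = (4 * theta)%:E * D)%E.
    under eq_integral do rewrite EFinM.
    by rewrite ge0_integralZl//; exact/measurable_EFinP.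
  have I2 : (\int[P]_w (F2 w)%:E = (expR (- (m%:R / (4 * theta))))%:E *
      (expR (psi m%:R / m%:R ^+ 2))%:E)%E.
    rewrite -Em; under eq_integral do rewrite /F2 mulrC EFinM.
    by rewrite ge0_integralZl//; exact/measurable_EFinP/mexp.
  have I0 : (\int[P]_w 1%:E = 1)%E.
    by rewrite integral_cst// mul1e [LHS](@probability_setT _ _ _ P).
  rewrite -Et -I1 -I2 -[X in (_ <= X + _)%E]I0.
  have mE1 : measurable_fun setT (EFin \o F1) by exact/measurable_EFinP.
  have mE2 : measurable_fun setT (EFin \o F2) by exact/measurable_EFinP.
  rewrite -ge0_integralD//; last 2 first.
  - by move=> w _; rewrite lee_fin.
  - by move=> w _; rewrite lee_fin.
  rewrite -ge0_integralD//; last 2 first.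
  - by move=> w _; rewrite adde_ge0// lee_fin.
  - exact: emeasurable_funD.
  apply: ge0_le_integral => //.
  - exact/measurable_EFinP/mexp.
  - by apply: emeasurable_funD => //; exact: emeasurable_funD.
  - by move=> w _; rewrite -!EFinD lee_fin addrA; exact: expR_truncation.
rewrite -(fineK Dfin) -!EFinM -!EFinD lee_fin => /le_trans; apply.
rewrite addrA lerD//; last first.
  rewrite mulrC ler_wpM2r ?expR_ge0// ler_expR ler_pdivrMr ?exprn_gt0//.
  exact: psiA.
rewrite lerD2l ler_wpM2l ?mulr_ge0//.
by rewrite -lee_fin fineK.
Qed.

(** By e^u >= 1 + u the estimate bounds psi(theta)/m^2. Multiplied by m^2, its last term vanishes as
    m grows, which leaves 4 C theta. *)
Lemma levy_khintchine_linear : bounded_variation_paths X ->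
  exists C, forall l, 1 <= l -> psi l <= C * l.
Proof.
move=> X_bv; have [_ levyPi _] := X_triplet.
have [C C0 CN] := integral_expR_norm_increment X_levy X_bv.
have [A psiA] := levy_khintchine_le_sq gamma sigma levyPi.
exists (4 * C) => theta t1; have t0 : 0 < theta by lra.
(* From e^(-y) <= 6 / y^3 at y = m / (4 theta): after multiplication by m^2 the remainder is at most
   K / m. *)
pose K := expR A * (6 * 4 ^+ 3) * theta ^+ 3.
have K0 : 0 < K by rewrite !mulr_gt0 ?expR_gt0 ?exprn_gt0.
have step (m : nat) : 2 * theta <= m%:R -> psi theta <= 4 * C * theta + K / m%:R.
  move=> mt; have m0 : 0 < m%:R :> R by lra.
  have m2 : 0 < m%:R ^+ 2 :> R by rewrite exprn_gt0.
  have := increment_estimate t1 mt CN psiA.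
  set y := m%:R / (4 * theta).
  have y0 : 0 < y by rewrite divr_gt0// mulr_gt0.
  have ey : expR (- y) <= 6 / y ^+ 3.
    rewrite expRN -[6 / _]invrK invf_div lef_pV2 ?posrE ?expR_gt0 ?divr_gt0 ?exprn_gt0//.
    have := expR_ge1Dxn 2%N (ltW y0); rewrite (_ : 3`!%:R = 6)//; lra.
  have h1 := expR_ge1Dx (psi theta / m%:R ^+ 2) => h2.
  have h3 : expR A * expR (- y) <= expR A * (6 / y ^+ 3) by rewrite ler_wpM2l ?expR_ge0.
  have : psi theta / m%:R ^+ 2 <= (4 * C * theta + K / m%:R) / m%:R ^+ 2.
    apply: (@le_trans _ _ (4 * theta * (C / m%:R ^+ 2) + expR A * (6 / y ^+ 3))); first lra.
    rewrite le_eqVlt; apply/orP; left; apply/eqP; rewrite /y /K; field.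
    by rewrite !gt_eqF.
  by rewrite ler_pM2r ?invr_gt0.
rewrite leNgt; apply/negP => lt.
pose e := psi theta - 4 * C * theta.
have e0 : 0 < e by rewrite /e subr_gt0.
pose m := (Num.truncn (2 * theta + K / e)).+1.
have mgt : 2 * theta + K / e < m%:R by exact: truncnS_gt.
have Ke : 0 < K / e by exact: divr_gt0.
have /step h : 2 * theta <= m%:R by lra.
have m0 : 0 < m%:R :> R by lra.
have : K / m%:R < e.
  by rewrite ltr_pdivrMr// mulrC -ltr_pdivrMr//; lra.
by move: h; rewrite /e; lra.
Qed.

End BoundedVariation.

Theorem theorem2p9 (R : realType) (d : measure_display) (T : measurableType d)
    (P : probability T R) (X : R -> {RV P >-> R})
    (gamma sigma : R) (Pi : {measure set R -> \bar R}) (W : R -> R -> R)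
    (X_levy : spectrally_negative_levy_process X)
    (X_triplet : levy_triplet gamma sigma Pi X)
    (X_bv : bounded_variation_paths X)
    (W_scale : forall q : R, 0 <= q ->
       scale_function (levy_khintchine gamma sigma Pi) q (W q)) :
  [<-> C1_pos (W 0);
       forall q : R, 0 <= q -> C1_pos (W q);
       C0_pos (tail Pi)].
Proof.
have [levyX _ _] := X_levy; have [sigma0 levyPi _] := X_triplet.
have [C psiC] := levy_khintchine_linear levyX X_triplet X_bv.
have [sigma_eq0 int_x] := linear_levy_khintchine levyPi sigma0 psiC.
rewrite sigma_eq0 in W_scale.
have smooth q (q0 : 0 <= q) := scale_function_smooth levyPi int_x W_scale q0.
tfae.
- by move=> /(smooth 0 (lexx 0)) cT q q0; apply/smooth.
- by move=> /(_ 0 (lexx 0)) /(smooth 0 (lexx 0)).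
- by move=> cT; apply/smooth.
Qed.
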